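(* Let $\mu$ be a convex probability measure on $\mathbb{R}^d$ such that $\int_{\mathbb{R}^d}e^{\varepsilon|x|^\alpha}d\mu<\infty$ for some $\alpha>1$ and $\varepsilon>0$, and let $\beta=\frac{\alpha}{\alpha-1}$. Then there exists $C>0$ such that for every smooth $f$ $$\mathrm{Ent}_\mu|f|^\beta\le C\Bigl[\int_{\mathbb{R}^d}|\nabla f|^\beta d\mu+\mathrm{Var}_\mu|f|^{\frac\beta2}\Bigr].$$
   Context: A probability measure on $\mathbb{R}^d$ is called convex if it has the form $e^{-V}dx$ with $V$ a convex function (log-concave measure). For $h\ge0$, $\mathrm{Ent}_\mu h=\int h\log\bigl(\frac{h}{\int h\,d\mu}\bigr)d\mu$ (with $0\log0=0$); $\mathrm{Var}_\mu g=\int g^2d\mu-(\int g\,d\mu)^2$. Here $f$ ranges over smooth functions with $0<\int|f|^\beta d\mu<\infty$; the right-hand side may be $+\infty$. *)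

(* Defs.v *)
From HB Require Import structures.
From mathcomp Require Import all_boot all_order all_algebra.
From mathcomp Require Import all_classical all_reals all_analysis.
From mathcomp Require Import measurable_realfun.

Set Implicit Arguments.
Unset Strict Implicit.
Unset Printing Implicit Defensive.

Import Order.TTheory GRing.Theory Num.Theory.
Import numFieldNormedType.Exports.

Local Open Scope classical_set_scope.
Local Open Scope ring_scope.

(* R^d is 'rV[R]_d, with the product sigma-algebra, i.e. the one generated by
   the coordinates (the library only has this for n.-tuple T); it coincides
   with the Borel sigma-algebra. *)
Definition rV_display : measure_display -> measure_display.
Proof. exact. Qed.

Section measurable_rV.
Context (R : realType) (n : nat).

Let coord (i : 'I_n) (x : 'rV[R]_n) : R := x ord0 i.

Let rV_set0 : g_sigma_preimage coord set0.
Proof. exact: sigma_algebra0. Qed.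

Let rV_setC A : g_sigma_preimage coord A -> g_sigma_preimage coord (~` A).
Proof. exact: sigma_algebraC. Qed.

Let rV_bigcup (F : (set 'rV[R]_n)^nat) :
  (forall i, g_sigma_preimage coord (F i)) ->
  g_sigma_preimage coord (\bigcup_i F i).
Proof. exact: sigma_algebra_bigcup. Qed.

HB.instance Definition _ :=
  @isMeasurable.Build (rV_display default_measure_display)
    'rV[R]_n (g_sigma_preimage coord) rV_set0 rV_setC rV_bigcup.

Lemma measurable_coord (i : 'I_n) :
  measurable_fun [set: 'rV[R]_n] (fun x : 'rV[R]_n => x ord0 i).
Proof.
move=> _ Y mY; rewrite setTI; apply: sub_sigma_algebra => /=.
rewrite -bigcup_seq/=; exists i => /=; first by rewrite mem_index_enum.
by exists Y => //; rewrite setTI.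
Qed.

Lemma measurable_fun_rVP d (T : measurableType d) (f : T -> 'rV[R]_n) :
  (forall i, measurable_fun [set: T] (fun x => f x ord0 i)) ->
  measurable_fun [set: T] f.
Proof.
move=> mf; apply: (@measurability _ _ _ _ _ f
  (\big[setU/set0]_(i < n) preimage_set_system setT (coord i) measurable)) => //.
move=> _ [B + <-]; rewrite -bigcup_seq => -[i _ [C mC <-]].
rewrite !setTI -comp_preimage -[X in measurable X]setTI.
exact: mf.
Qed.

End measurable_rV.

(* Lebesgue measure on R^n, built inductively: the Dirac mass at the unique
   point of R^0, then the image of lebesgue_measure \x lebesgue_rV n under the
   identification (a, x) |-> (a, x_1, ..., x_n) of R * R^n with R^n.+1. *)
Definition cons_rV (R : realType) n (p : R * 'rV[R]_n) : 'rV[R]_n.+1 :=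
  row_mx p.1%:M p.2.

Lemma cons_rV0 (R : realType) n (p : R * 'rV[R]_n) : cons_rV p ord0 ord0 = p.1.
Proof.
rewrite /cons_rV mxE; case: splitP => [j|j /eqP]; last by rewrite /= add1n.
by move=> _; rewrite (ord1 j) mxE.
Qed.

Lemma cons_rVS (R : realType) n (p : R * 'rV[R]_n) i :
  cons_rV p ord0 (lift ord0 i) = p.2 ord0 i.
Proof.
rewrite /cons_rV mxE; case: splitP => j; first by rewrite (ord1 j).
by rewrite /= /bump/= !add1n => -[ij]; congr (p.2 _ _); exact/val_inj.
Qed.

Lemma measurable_cons_rV (R : realType) n :
  measurable_fun [set: R * 'rV[R]_n] (@cons_rV R n).
Proof.
apply: measurable_fun_rVP => i; case: (unliftP ord0 i) => [j|] ->.
  under eq_fun do rewrite cons_rVS.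
  exact: (measurableT_comp (measurable_coord j) measurable_snd).
by under eq_fun do rewrite cons_rV0; exact: measurable_fst.
Qed.

Section lebesgue_rV_succ.
Local Open Scope ereal_scope.
Context (R : realType) (n : nat).
Variable m : {sigma_finite_measure set 'rV[R]_n -> \bar R}.

Definition lebesgue_rV_succ : set 'rV[R]_n.+1 -> \bar R :=
  pushforward (@lebesgue_measure R \x m) (@cons_rV R n).

Let succ0 : lebesgue_rV_succ set0 = 0.
Proof. by rewrite /lebesgue_rV_succ /pushforward preimage_set0 measure0. Qed.

Let succ_ge0 A : 0 <= lebesgue_rV_succ A.
Proof. by rewrite /lebesgue_rV_succ /pushforward measure_ge0. Qed.

Let succ_sigma_additive : semi_sigma_additive lebesgue_rV_succ.
Proof.
have mcons := @measurable_cons_rV R n.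
exact: (@measure_semi_sigma_additive _ _ _
  (measure_function_pushforward__canonical__measure_function_Measure
    (@lebesgue_measure R \x m) mcons)).
Qed.

HB.instance Definition _ := isMeasure.Build _ _ _ lebesgue_rV_succ
  succ0 succ_ge0 succ_sigma_additive.

Let succ_sigma_finite : sigma_finite setT lebesgue_rV_succ.
Proof.
have /sigma_finiteP[F [UF ndF Foo]] := sigma_finiteT (@lebesgue_measure R).
have /sigma_finiteP[G [UG ndG Goo]] := sigma_finiteT m.
pose split (x : 'rV[R]_n.+1) : R * 'rV[R]_n :=
  (x ord0 ord0, \row_i x ord0 (lift ord0 i)).
have msplit : measurable_fun [set: 'rV[R]_n.+1] split.
  apply: measurable_fun_pair; first exact: measurable_coord.
  apply: measurable_fun_rVP => i; under eq_fun do rewrite mxE.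
  exact: measurable_coord.
have consK : cancel (@cons_rV R n) split.
  move=> p; rewrite /split cons_rV0 [RHS]surjective_pairing; congr pair.
  by apply/rowP => i; rewrite mxE cons_rVS.
exists (fun k => split @^-1` (F k `*` G k)).
  rewrite -preimage_bigcup (_ : \bigcup_k (F k `*` G k) = setT) ?preimage_setT//.
  rewrite -subTset => -[a x] _.
  have [i _ Fia] : (\bigcup_k F k) a by rewrite -UF.
  have [j _ Gjx] : (\bigcup_k G k) x by rewrite -UG.
  exists (maxn i j) => //; split => /=.
    by move: Fia; exact/subsetPset/ndF/leq_maxl.
  by move: Gjx; exact/subsetPset/ndG/leq_maxr.
move=> k; have [mF Fkoo] := Foo k; have [mG Gkoo] := Goo k; split.
  rewrite -[X in measurable X]setTI; apply: msplit => //.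
  exact: measurableX.
rewrite /lebesgue_rV_succ /pushforward -comp_preimage.
rewrite (_ : split \o _ = id) ?preimage_id; last exact/funext.
by rewrite product_measure1E// lte_mul_pinfty// ge0_fin_numE.
Qed.

HB.instance Definition _ :=
  @Measure_isSigmaFinite.Build _ _ _ lebesgue_rV_succ succ_sigma_finite.

End lebesgue_rV_succ.

Fixpoint lebesgue_rV (R : realType) (n : nat) :
    {sigma_finite_measure set 'rV[R]_n -> \bar R} :=
  match n return {sigma_finite_measure set 'rV[R]_n -> \bar R} with
  | 0%N => dirac (0 : 'rV[R]_0)
  | n'.+1 => lebesgue_rV_succ (lebesgue_rV R n')
  end.

Section euclidean.
Context (R : realType) (d : nat).

(* The norm `|x| that the library puts on 'rV[R]_d is the sup norm. *)
Definition eucl_norm (x : 'rV[R]_d) : R :=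
  Num.sqrt (\sum_(i < d) (x ord0 i) ^+ 2).

Definition partial (i : 'I_d) (f : 'rV[R]_d -> R) : 'rV[R]_d -> R :=
  fun x => 'D_(delta_mx ord0 i) f x.

Definition gradient (f : 'rV[R]_d -> R) (x : 'rV[R]_d) : 'rV[R]_d :=
  \row_i partial i f x.

Fixpoint Ck (k : nat) (f : 'rV[R]_d -> R) : Prop :=
  continuous f /\
  match k with
  | 0%N => True
  | k'.+1 => forall i : 'I_d,
      (forall x, derivable f x (delta_mx ord0 i)) /\ Ck k' (partial i f)
  end.

Definition smooth (f : 'rV[R]_d -> R) : Prop := forall k, Ck k f.

End euclidean.

Section convex_measure.
Context (R : realType) (d : nat).
Local Open Scope ereal_scope.

(* Convex functions are allowed to take the value +oo, as is usual for
   log-concave measures, so that, e.g., the uniform measure on a convex body is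
   included. For t = 0 or 1 the convention 0 * +oo = 0 applies. *)
Definition ereal_convex (V : 'rV[R]_d -> \bar R) : Prop :=
  (forall x, V x != -oo) /\
  forall (x y : 'rV[R]_d) (t : R), (0 <= t <= 1)%R ->
    V ((1 - t) *: x + t *: y)%R <= (1 - t)%:E * V x + t%:E * V y.

(* Borel measurability of V is automatic when V is finite; in general V can be
   replaced by its lower semicontinuous envelope, which only modifies it on the
   Lebesgue-negligible boundary of the domain of V. *)
Definition convex_measure (mu : {measure set 'rV[R]_d -> \bar R}) : Prop :=
  exists V : 'rV[R]_d -> \bar R,
    [/\ ereal_convex V,
        measurable_fun [set: 'rV[R]_d] V &
        forall A, measurable A ->
          mu A = \int[lebesgue_rV R d]_(x in A) expeR (- V x)].

End convex_measure.

(* Meant for h >= 0 with 0 < \int h < +oo. *)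
Definition entropy (R : realType) disp (T : measurableType disp)
    (mu : probability T R) (h : T -> R) : \bar R :=
  (\int[mu]_x (h x * ln (h x / (\int[mu]_y h y)%R))%:E)%E.

(* Main.v *)
(* The proof replaces optimal transport by the Prekopa-Leindler inequality.
   For F >= 0 with local upper gradient G, put g = F^beta and apply the
   inequality for mu, restricted to a ball, to the functions g^(1/(1-t)) and
   exp(-delta |y|^alpha). Young's inequality bounds the supremal convolution
     sup { g(x) exp(-t delta |y|^alpha) : (1-t) x + t y = z }
   by exp(t delta (1 + |z|^alpha)) g(z) + C t G(z)^beta, because
   (beta - 1) alpha = beta. Dividing by t as t -> 0 bounds Ent g by
   int G^beta + delta int |z|^alpha g + int g; by the entropy inequality and
   the exponential moment, the middle term is at most (1/2) Ent g + K int g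
   for delta = eps / 4, and this gives a defective inequality
     Ent g <= C1 int G^beta + C2 int g.
   To tighten it, normalise int |f|^beta = 1 and apply it to F = (|f| - 2)_+:
   where |f| <= 4 the relative entropy density is at most
   C (|f|^(beta/2) - 1)^2, where |f| > 4 it is controlled by that of F, and
   int F^beta <= C int (|f|^(beta/2) - 1)^2 <= 2 C Var |f|^(beta/2). *)
Require Import Defs.
From HB Require Import structures.
From mathcomp Require Import all_boot all_order all_algebra.
From mathcomp Require Import all_classical all_reals all_analysis.
From mathcomp Require Import ring lra.
From mathcomp Require Import measurable_realfun.

Set Implicit Arguments.
Unset Strict Implicit.
Unset Printing Implicit Defensive.

Import Order.TTheory GRing.Theory Num.Theory.
Import numFieldNormedType.Exports.

Local Open Scope classical_set_scope.
Local Open Scope ring_scope.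

(** * Prekopa-Leindler inequality *)

Section one_dim.
Context {R : realType}.
Local Notation leb := (@lebesgue_measure R).
Local Open Scope ereal_scope.

(** No limit in [t] is taken. On a fixed ball a single small [t] is chosen, and both sides of the
    Prekopa-Leindler inequality are replaced by bounds affine in [t] with the same constant term int
    g: tangent lines of the exponential below, a linear bound on exp near 0 above. The constant
    terms cancel exactly and the rest is divided by [t], so nothing is differentiated under an
    integral. The ball is what lets one [t] serve all points: there the radius attached to the upper
    gradient is uniform, |x| is bounded and every integral is finite. While [t] may depend on the
    radius, the final constants may not; hence the mass of exp(-delta |y|^alpha) is bounded below on
    one fixed ball. Truncating |f| destroys smoothness, so the argument is run for one-sided local
    upper gradients, up to a slack [eta] whose beta-th power is finally set to int g. Balls and
    distances use the sup norm: it is below the Euclidean norm, so the moment hypothesis is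
    inherited, at the price of a dimensional factor on the gradient. *)

Lemma lebesgue_measure_affine (k c : R) (A : set R) : (0 < k)%R ->
  measurable A -> leb ((fun x => k * x + c)%R @^-1` A) = (k^-1)%:E * leb A.
Proof.
move=> k0 mA.
pose f := (fun x : measurableTypeR R => (k * x + c)%R : measurableTypeR R).
have mf : measurable_fun [set: measurableTypeR R] f.
  by apply: measurable_funD => //; exact: measurable_funM.
pose P : {measure set (measurableTypeR R) -> \bar R} :=
  measure_function_pushforward__canonical__measure_function_Measure leb mf.
pose kp := NngNum (ltW k0).
have -> : leb A = mscale kp P A.
  apply: lebesgue_measure_unique => // _ [[a b]] _ <-.
  change (leb `]a, b] = k%:E * leb (f @^-1` `]a, b]%classic)).
  rewrite [X in (_ * leb X)](_ : _ = `]((a - c) / k)%R, ((b - c) / k)%R]%classic); last first.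
    apply/seteqP; split => x /=; rewrite !in_itv/= /f.
      by rewrite ltr_pdivrMr// ler_pdivlMr// ltrBlDr lerBrDr ![(x * k)%R]mulrC.
    by rewrite ltr_pdivrMr// ler_pdivlMr// ltrBlDr lerBrDr ![(x * k)%R]mulrC.
  rewrite !lebesgue_measure_itv/= !lte_fin ltr_pM2r ?invr_gt0// ltrD2r.
  case: ifPn => _; last by rewrite mule0.
  rewrite -!EFinB -EFinM; congr EFin.
  by rewrite -mulrBl mulrCA divff ?gt_eqF// mulr1 opprB addrA subrK.
change (leb (f @^-1` A) = (k^-1)%:E * (k%:E * leb (f @^-1` A))).
rewrite muleA -EFinM mulVf ?gt_eqF//.
by rewrite mul1e.
Qed.

Lemma measurable_set_ltr d (T : measurableType d) (f g : T -> R) :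
  measurable_fun [set: T] f -> measurable_fun [set: T] g ->
  measurable [set x | (f x < g x)%R].
Proof.
move=> mf mg; have := measurable_fun_ltr mf mg.
by move=> /(_ measurableT [set true]); rewrite setTI; exact.
Qed.

Lemma measurable_set_ler d (T : measurableType d) (f g : T -> R) :
  measurable_fun [set: T] f -> measurable_fun [set: T] g ->
  measurable [set x | (f x <= g x)%R].
Proof.
move=> mf mg; have := measurable_fun_ler mf mg.
by move=> /(_ measurableT [set true]); rewrite setTI; exact.
Qed.

(** Tonelli for the indicator of the region under the graph of [f]: its vertical sections have
    length [f x], its horizontal ones are the superlevel sets. *)
Lemma layer_cake d (T : measurableType d)
    (m : {sigma_finite_measure set T -> \bar R}) (f : T -> R) :
  measurable_fun [set: T] f -> (forall x, (0 <= f x)%R) ->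
  \int[m]_x (f x)%:E = \int[leb]_(s in `[0%R, +oo[) m [set x | (s < f x)%R].
Proof.
move=> mf f0.
transitivity (\int[m]_x \int[leb]_s (\1_`[0%R, f x[ s)%:E).
  apply: eq_integral => x _; rewrite integral_indic// setIT/=.
  rewrite lebesgue_measure_itv/= lte_fin -EFinB subr0.
  by have := f0 x; rewrite le_eqVlt => /predU1P[<-|->]//; rewrite ltxx.
transitivity (\int[leb]_s \int[m]_x (\1_`[0%R, f x[ s)%:E).
  rewrite (fubini_tonelli (fun p : T * measurableTypeR R => (\1_`[0%R, f p.1[ p.2)%:E))//=.
  apply/measurable_EFinP/measurable_indic => /=.
  rewrite [X in measurable X](_ : _ =
     [set p : T * measurableTypeR R | (0 <= p.2)%R] `&`
     [set p : T * measurableTypeR R | (p.2 < f p.1)%R]); last first.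
    by apply/seteqP; split => p /=; rewrite in_itv/= => /andP.
  apply: measurableI; first exact: measurable_set_ler.
  apply: measurable_set_ltr => //; exact: (measurableT_comp mf measurable_fst).
rewrite [RHS]integral_mkcond/=.
apply: eq_integral => s _; rewrite patchE.
case: ifPn => [|] /=.
  rewrite inE/= in_itv/= andbT => s0.
  transitivity (\int[m]_x (\1_[set x | (s < f x)%R] x)%:E).
    apply: eq_integral => x _; rewrite !indicE; congr ((nat_of_bool _)%:R%:E).
    by apply/idP/idP; rewrite !inE/= in_itv/= s0.
  by rewrite integral_indic ?setIT//; exact: measurable_set_ltr.
rewrite notin_setE/= in_itv/= andbT => /negP s0.
by apply: integral0_eq => x _; rewrite indicE memNset//= in_itv/= (negbTE s0).
Qed.

(** Up to [e], [A] lies to the left of one of its points [a] and [B] to the right of one of its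
    points [b]. Then [C] contains copies of [A] scaled by [1 - t] and of [B] scaled by [t], placed
    on either side of [(1 - t) * a + t * b], so their measures add up. Measurability of the
    Minkowski sum never arises, since [C] is given. *)
Lemma brunn_minkowski1 (t : R) (A B C : set R) (k : R) : (0 < t < 1)%R ->
  measurable A -> measurable B -> measurable C -> A !=set0 -> B !=set0 ->
  A `<=` `[(- k)%R, k] -> B `<=` `[(- k)%R, k] ->
  (forall x y, A x -> B y -> C ((1 - t) * x + t * y)%R) ->
  (1 - t)%:E * leb A + t%:E * leb B <= leb C.
Proof.
move=> /andP[t0 t1] mA mB mC A0 B0 Ak Bk ABC.
have t1' : (0 < 1 - t)%R by rewrite subr_gt0.
apply/lee_addgt0Pr => e e0.
have supA : has_sup A.
  by split => //; exists k => x /Ak/=; rewrite in_itv => /andP[].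
have infB : has_inf B.
  by split => //; exists (- k)%R => x /Bk/=; rewrite in_itv => /andP[].
have [a Aa aS] := sup_adherent e0 supA.
have [b Bb bS] := inf_adherent e0 infB.
pose A1 := A `&` `]-oo, a].
pose B1 := B `&` `]b, +oo[.
have mA1 : measurable A1 by exact: measurableI.
have mB1 : measurable B1 by exact: measurableI.
have AA1 : leb A <= leb A1 + e%:E.
  apply: (@le_trans _ _ (leb (A1 `|` `[a, a + e]%classic))%R).
    apply: le_measure; rewrite ?inE//; first exact: measurableU.
    move=> x Ax; rewrite /A1/=; case: (leP x a) => xa; first by left.
    right; rewrite in_itv/= (ltW xa)/= ltW//.
    apply: le_lt_trans (ub_le_sup _ Ax) _; first by case: supA.
    by rewrite -ltrBlDr.
  apply: (le_trans (measureU2 _ _ _)) => //.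
  rewrite leeD2l//= lebesgue_measure_itv/= lte_fin ltrDl e0 -EFinB.
  by rewrite addrAC subrr add0r.
have BB1 : leb B <= leb B1 + e%:E.
  apply: (@le_trans _ _ (leb (B1 `|` `[b - e, b]%classic))%R).
    apply: le_measure; rewrite ?inE//; first exact: measurableU.
    move=> x Bx; rewrite /B1/= !in_itv/= andbT; case: (ltP b x) => xb; first by left.
    right; rewrite andbT ltW//.
    apply: lt_le_trans (ge_inf _ Bx); last by case: infB.
    by rewrite ltrBlDr.
  apply: (le_trans (measureU2 _ _ _)) => //.
  rewrite leeD2l//= lebesgue_measure_itv/= lte_fin gtrDl oppr_lt0 e0 -EFinB.
  by rewrite opprB addrC subrK.
(* These are the sets [(1 - t) A1 + t b] and [(1 - t) a + t B1], written as affine preimages so that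
   [lebesgue_measure_affine] computes their measure. *)
pose C1 := (fun x => (1 - t)^-1 * x + - ((1 - t)^-1 * (t * b)))%R @^-1` A1.
pose C2 := (fun x => t^-1 * x + - (t^-1 * ((1 - t) * a)))%R @^-1` B1.
have maff (u v : R) D : measurable D ->
    measurable ((fun x => u * x + v)%R @^-1` D : set R).
  move=> mD; rewrite -[X in measurable X]setTI.
  have : measurable_fun [set: R] (fun x : R => u * x + v)%R.
    by apply: measurable_funD => //; exact: measurable_funM.
  exact.
have leC1 : leb C1 = (1 - t)%:E * leb A1.
  by rewrite /C1 lebesgue_measure_affine ?invrK// invr_gt0.
have leC2 : leb C2 = t%:E * leb B1.
  by rewrite /C2 lebesgue_measure_affine ?invrK// invr_gt0.
have C12 : leb (C1 `|` C2) <= leb C.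
  apply: le_measure; rewrite ?inE//; first by apply: measurableU; exact: maff.
  move=> z [[Az _]|[Bz _]].
    have := ABC _ _ Az Bb.
    by rewrite -mulrBr mulrA divff ?gt_eqF// mul1r subrK.
  have := ABC _ _ Aa Bz.
  by rewrite -[X in (_ + t * X)%R]mulrBr mulrA divff ?gt_eqF// mul1r addrC subrK.
have : leb C1 + leb C2 <= leb C.
  rewrite -measureU//; [exact: maff|exact: maff|].
  rewrite -subset0 => z [[_ /=]]; rewrite in_itv/= => za [_ /=].
  rewrite in_itv/= andbT => bz.
  move: za bz; rewrite -!mulrBr ler_pdivrMl// ltr_pdivlMl// => za bz.
  move: za; rewrite leNgt => /negP; apply.
  by rewrite ltrBrDr addrC -ltrBrDr.
rewrite leC1 leC2 => le12.
apply: (@le_trans _ _ ((1 - t)%:E * (leb A1 + e%:E) + t%:E * (leb B1 + e%:E))).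
  by apply: leeD; apply: lee_wpmul2l => //; rewrite lee_fin ltW.
rewrite !ge0_muleDr ?lee_fin ?(ltW e0)// addeACA leeD// -!EFinM -EFinD lee_fin.
by rewrite -mulrDl subrK mul1r.
Qed.

End one_dim.

Section bounded_functions.
Context {R : realType}.
Local Notation leb := (@lebesgue_measure R).
Local Open Scope ereal_scope.

Lemma measurable_superlevel_measure d (T : measurableType d)
    (m : {sigma_finite_measure set T -> \bar R}) (f : T -> R) :
  measurable_fun [set: T] f ->
  measurable_fun [set: measurableTypeR R] (fun s : measurableTypeR R => m [set x | (s < f x)%R]).
Proof.
move=> mf.
have mA : measurable [set p : T * measurableTypeR R | (p.2 < f p.1)%R].
  apply: measurable_set_ltr => //; exact: (measurableT_comp mf measurable_fst).
apply: eq_measurable_fun (measurable_fun_ysection m mA) => s _ /=.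
by congr (m _); apply/seteqP; split => x; rewrite /ysection/= inE.
Qed.

(** Both [a] and [b] have supremum 1, so at each level below 1 their superlevel sets are nonempty
    and the one-dimensional Brunn-Minkowski inequality applies; integrating over the levels gives an
    arithmetic mean, which is stronger than the geometric one. *)
Lemma prekopa_leindler_bounded (t k : R) (a b c : R -> R) : (0 < t < 1)%R ->
  measurable_fun [set: R] a -> measurable_fun [set: R] b ->
  measurable_fun [set: R] c ->
  (forall x, (0 <= a x <= 1)%R) -> (forall x, (0 <= b x <= 1)%R) ->
  (forall x, (0 <= c x)%R) ->
  (forall x, a x != 0%R -> `[(- k)%R, k]%classic x) ->
  (forall x, b x != 0%R -> `[(- k)%R, k]%classic x) ->
  (forall s, (s < 1)%R -> exists x, (s < a x)%R) ->
  (forall s, (s < 1)%R -> exists x, (s < b x)%R) ->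
  (forall x y s, (0 <= s < 1)%R -> (s < a x)%R -> (s < b y)%R ->
    (s < c ((1 - t) * x + t * y))%R) ->
  (1 - t)%:E * \int[leb]_x (a x)%:E + t%:E * \int[leb]_x (b x)%:E
    <= \int[leb]_x (c x)%:E.
Proof.
move=> t01 ma mb mc a01 b01 c0 ak bk a1 b1 abc.
have /andP[t0 t1] := t01.
have ge0 (f : R -> R) : (forall x, (0 <= f x <= 1)%R) -> forall x, (0 <= f x)%R.
  by move=> f01 x; have /andP[] := f01 x.
have msl (f : R -> R) : measurable_fun [set: R] f ->
  measurable_fun (`[0%R, +oo[%classic : set R) (fun s : R => leb [set x | (s < f x)%R]).
  by move=> mf; apply: measurable_funTS; exact: measurable_superlevel_measure.
rewrite !layer_cake//; [|exact: ge0..].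
rewrite -!ge0_integralZl//; first last.
- by rewrite lee_fin subr_ge0 ltW.
- exact: msl.
- by rewrite lee_fin ltW.
- exact: msl.
rewrite -ge0_integralD//; first last.
- by apply: measurable_funeM; exact: msl.
- by move=> x _; rewrite mule_ge0// lee_fin ltW.
- by apply: measurable_funeM; exact: msl.
- by move=> x _; rewrite mule_ge0// lee_fin subr_ge0 ltW.
apply: ge0_le_integral => //.
- move=> x _; rewrite adde_ge0// mule_ge0// lee_fin; [|exact: ltW].
  by rewrite subr_ge0 ltW.
- by apply: emeasurable_funD; apply: measurable_funeM; exact: msl.
- exact: msl.
move=> s /=; rewrite in_itv/= andbT => s0.
have [s1|s1] := ltP s 1%R; last first.
  have e0 (f : R -> R) : (forall x, (0 <= f x <= 1)%R) -> [set x | (s < f x)%R] = set0.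
    move=> f01; rewrite -subset0 => x/=; rewrite ltNge => /negP; apply.
    by apply: le_trans s1; have /andP[] := f01 x.
  have l0 : leb set0 = 0 by exact: measure0.
  by rewrite (e0 a)// (e0 b)// l0 !mule0 adde0.
have supp (f : R -> R) : (forall x, f x != 0%R -> `[(- k)%R, k]%classic x) ->
    [set x | (s < f x)%R] `<=` `[(- k)%R, k].
  by move=> fk x/= sfx; apply: fk; rewrite gt_eqF// (le_lt_trans s0).
apply: (@brunn_minkowski1 _ _ _ _ _ k) => //.
- exact: measurable_set_ltr.
- exact: measurable_set_ltr.
- exact: measurable_set_ltr.
- by have [x] := a1 _ s1; exists x.
- by have [x] := b1 _ s1; exists x.
- exact: supp.
- exact: supp.
- by move=> x y; apply: abc; rewrite s0.
Qed.

Lemma powR_AMGM (t x y : R) : (0 < t < 1)%R -> (0 <= x)%R -> (0 <= y)%R ->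
  (x `^ (1 - t) * y `^ t <= (1 - t) * x + t * y)%R.
Proof.
move=> /andP[t0 t1].
have t1' : (0 < 1 - t)%R by rewrite subr_gt0.
rewrite le_eqVlt => /predU1P[<-|x0].
  by move=> y0; rewrite powR0 ?gt_eqF// mul0r mulr0 add0r mulr_ge0// ltW.
rewrite le_eqVlt => /predU1P[<-|y0].
  by rewrite (@powR0 _ t) ?gt_eqF// !mulr0 addr0 mulr_ge0// ltW.
have := @convex_expR R (Itv01 (ltW t0) (ltW t1)) (ln y) (ln x).
rewrite !convRE/= /unstable.onem !lnK// => h.
rewrite [leRHS]addrC; apply: le_trans h.
by rewrite expRD /powR !gt_eqF// mulrC.
Qed.

End bounded_functions.

(** * Prekopa-Leindler on the line for functions with values in [0, +oo] *)

Section extended_functions.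
Context {R : realType}.
Local Notation leb := (@lebesgue_measure R).
Local Open Scope ereal_scope.

(* [p `^ (1 - t) * q `^ t <= r], phrased with real minorants so as to avoid
   powers and products of infinite values. *)
Definition geomean_le (t : R) (p q r : \bar R) : Prop :=
  forall A B : R, (0 <= A)%R -> (0 <= B)%R -> A%:E <= p -> B%:E <= q ->
    (A `^ (1 - t) * B `^ t)%:E <= r.

(** The exponents add up to 1, so scaling both minorants by [1 - e] scales the product by exactly
    [1 - e]; then [e] tends to 0. *)
Lemma geomean_le_lt (t : R) (p q r : \bar R) : (0 < t < 1)%R -> 0 <= r ->
  (forall A B : R, (0 < A)%R -> (0 < B)%R -> A%:E < p -> B%:E < q ->
    (A `^ (1 - t) * B `^ t)%:E <= r) ->
  geomean_le t p q r.
Proof.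
move=> /andP[t0 t1] r0 pqr A B.
have t1' : (0 < 1 - t)%R by rewrite subr_gt0.
rewrite le_eqVlt => /predU1P[<-|A0].
  by rewrite powR0 ?gt_eqF// mul0r.
rewrite le_eqVlt => /predU1P[<-|B0].
  by rewrite (@powR0 _ t) ?gt_eqF// mulr0.
move=> Ap Bq; set X := (_ * _)%R.
have X0 : (0 < X)%R by rewrite mulr_gt0// powR_gt0.
have eX e : (0 < e < 1)%R -> ((1 - e) * X)%:E <= r.
  move=> /andP[e0 e1].
  have e1' : (0 < 1 - e)%R by rewrite subr_gt0.
  have -> : ((1 - e) * X = ((1 - e) * A) `^ (1 - t) * ((1 - e) * B) `^ t)%R.
    rewrite !powRM ?ltW// mulrACA -powRD ?gt_eqF// ?subrK ?powRr1 ?ltW//.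
  apply: pqr; rewrite ?mulr_gt0//.
    by apply: lt_le_trans Ap; rewrite lte_fin gtr_pMl// gtrBl.
  by apply: lt_le_trans Bq; rewrite lte_fin gtr_pMl// gtrBl.
case: r r0 eX {pqr} => [r| |]// r0 eX; last by rewrite leey.
rewrite lee_fin leNgt; apply/negP => rX.
(* This [e] puts [(1 - e) * X] at the midpoint of [r] and [X]. *)
have rX2 : (r < (1 - (X - r) / (2 * X)) * X)%R.
  rewrite (_ : ((1 - (X - r) / (2 * X)) * X = X - (X - r) / 2)%R); first by lra.
  by field; rewrite gt_eqF.
have := eX ((X - r) / (2 * X))%R; rewrite lee_fin leNgt rX2 => h.
suff : false by []; apply: h.
have X20 : (0 < 2 * X)%R by rewrite mulr_gt0.
rewrite divr_gt0 ?subr_gt0//= ltr_pdivrMr// mul1r.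
rewrite lee_fin in r0; lra.
Qed.

Lemma nondecreasing_integral_le d (T : measurableType d)
    (m : {measure set T -> \bar R}) (g : nat -> T -> \bar R) (f : T -> \bar R) M :
  (forall k, measurable_fun [set: T] (g k)) -> (forall k x, 0 <= g k x) ->
  (forall x, {homo g^~ x : i j / (i <= j)%N >-> i <= j}) ->
  (forall x, g k x @[k --> \oo] --> f x) ->
  (forall k, \int[m]_x g k x <= M) -> \int[m]_x f x <= M.
Proof.
move=> mg g0 ndg gf gM.
have -> : \int[m]_x f x = \int[m]_x limn (g^~ x).
  by apply: eq_integral => x _; apply/esym/cvg_lim => //; exact: gf.
rewrite monotone_convergence//; apply: lime_le; last exact: nearW.
apply: ereal_nondecreasing_is_cvgn => i j ij.
by apply: ge0_le_integral => // x _; exact: ndg.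
Qed.

(** Cuts both the values and the support, since the bounded version needs a finite supremum and a
    bounded support. *)
Let trunc (a : R -> \bar R) (k : nat) (x : R) : R :=
  (fine (mine (a x) k%:R%:E) * \1_`[(- k%:R)%R, k%:R] x)%R.

Let trunc_fin (a : R -> \bar R) (a0 : forall x, 0 <= a x) (k : nat) x :
  (fine (mine (a x) k%:R%:E))%:E = mine (a x) k%:R%:E.
Proof.
rewrite fineK// ge0_fin_numE; first by rewrite gt_min ltry orbT.
by rewrite le_min a0 lee_fin/=.
Qed.

Let trunc_ge0 (a : R -> \bar R) (a0 : forall x, 0 <= a x) k x : (0 <= trunc a k x)%R.
Proof.
rewrite mulr_ge0//; first by rewrite -lee_fin trunc_fin// le_min a0 lee_fin/=.
Qed.

Let trunc_le_bnd (a : R -> \bar R) (a0 : forall x, 0 <= a x) k x :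
  (trunc a k x <= k%:R)%R.
Proof.
rewrite /trunc indicE; case: (_ \in _); rewrite ?mulr1 ?mulr0//.
by rewrite -lee_fin trunc_fin// ge_min lexx orbT.
Qed.

Let trunc_le (a : R -> \bar R) (a0 : forall x, 0 <= a x) k x :
  (trunc a k x)%:E <= a x.
Proof.
rewrite /trunc indicE; case: (_ \in _); rewrite ?mulr1 ?mulr0//.
by rewrite trunc_fin// ge_min lexx.
Qed.

Let measurable_trunc (a : R -> \bar R) k : measurable_fun [set: R] a ->
  measurable_fun [set: R] (trunc a k).
Proof.
move=> ma; apply: measurable_funM => //.
by apply: measurableT_comp => //; exact: measurable_mine.
Qed.

Let integral_trunc (a : R -> \bar R) (A : R) : (forall x, 0 <= a x) ->
  measurable_fun [set: R] a -> A%:E < \int[leb]_x a x ->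
  exists k, A%:E < \int[leb]_x (trunc a k x)%:E.
Proof.
move=> a0 ma Aa; apply: contrapT => /forallNP H.
suff : \int[leb]_x a x <= A%:E by rewrite leNgt Aa.
apply: (@nondecreasing_integral_le _ _ leb (fun k x => (trunc a k x)%:E)).
- by move=> k; apply/measurable_EFinP; exact: measurable_trunc.
- by move=> k x; rewrite lee_fin trunc_ge0.
- move=> x i j ij; have ijR : (i%:R <= j%:R :> R)%R by rewrite ler_nat.
  rewrite lee_fin /trunc ler_pM//.
  + by rewrite -lee_fin trunc_fin// le_min a0 lee_fin/=.
  + rewrite -lee_fin !trunc_fin// le_min !ge_min lexx/=.
    by rewrite !lee_fin ijR orbT.
  + rewrite !indicE ler_nat; case: (boolP (_ \in _)) => //.
    rewrite !inE/= !in_itv/= -!ler_norml => xi.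
    by rewrite (_ : _ \in _) ?inE//= in_itv/= -ler_norml (le_trans xi).
- move=> x; have [N Nx] : exists N, forall k, (N <= k)%N -> (`|x| <= k%:R)%R.
    exists (Num.trunc `|x|).+1 => k Nk.
    by rewrite (le_trans (ltW (truncnS_gt _)))// ler_nat.
  have xk k : (N <= k)%N -> (trunc a k x)%:E = mine (a x) k%:R%:E.
    move=> Nk; rewrite /trunc indicE mem_set/= ?mulr1 ?trunc_fin//.
    by rewrite in_itv/= -ler_norml Nx.
  case E : (a x) (a0 x) => [r| |]// r0.
  + apply: cvg_near_cst; exists (maxn N (Num.trunc r).+1) => // k /=.
    rewrite geq_max => /andP[Nk rk]; rewrite xk// E min_l// lee_fin.
    by rewrite (le_trans (ltW (truncnS_gt _)))// ler_nat.
  + apply/cvgeyPge => B; exists (maxn N (Num.trunc B).+1) => // k /=.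
    rewrite geq_max => /andP[Nk rk]; rewrite xk// E min_r ?leey// lee_fin.
    by rewrite (le_trans (ltW (truncnS_gt _)))// ler_nat.
- by move=> k; rewrite leNgt; exact/negP/H.
Qed.

(** Strict minorants of the integrals are already reached by truncations. Dividing these by their
    suprema gives the normalised situation, and the arithmetic-geometric mean inequality turns its
    conclusion into the multiplicative one, which is homogeneous, so the normalisation can be
    undone. *)
Theorem prekopa_leindler_line (t : R) (a b c : R -> \bar R) : (0 < t < 1)%R ->
  measurable_fun [set: R] a -> measurable_fun [set: R] b ->
  measurable_fun [set: R] c ->
  (forall x, 0 <= a x) -> (forall x, 0 <= b x) -> (forall x, 0 <= c x) ->
  (forall x y, geomean_le t (a x) (b y) (c ((1 - t) * x + t * y)%R)) ->
  geomean_le t (\int[leb]_x a x) (\int[leb]_x b x) (\int[leb]_x c x).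
Proof.
move=> t01 ma mb mc a0 b0 c0 abc; have /andP[t0 t1] := t01.
have t1' : (0 < 1 - t)%R by rewrite subr_gt0.
apply: geomean_le_lt => //; first exact: integral_ge0.
move=> A B A0 B0 /integral_trunc-/(_ a0 ma)[i Ai] /integral_trunc-/(_ b0 mb)[j Bj].
have supP (f : R -> \bar R) (k : nat) (D : R) : (forall x, 0 <= f x) -> (0 < D)%R ->
    D%:E < \int[leb]_x (trunc f k x)%:E ->
    exists2 M : R, (0 < M)%R & (forall x, (trunc f k x <= M)%R) /\
      (forall s, (s < 1)%R -> exists x, (s < M^-1 * trunc f k x)%R).
  move=> f0 D0 Df; pose E := [set trunc f k x | x in [set: R]].
  have supE : has_sup E.
    split; first by exists (trunc f k 0), 0%R.
    by exists k%:R => _ [x _ <-]; exact: trunc_le_bnd.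
  have leE x : (trunc f k x <= sup E)%R.
    by apply: ub_le_sup; [case: supE|exists x].
  have M0 : (0 < sup E)%R.
    rewrite ltNge; apply/negP => M0; move: Df; rewrite integral0_eq ?lte_fin ?ltNge ?(ltW D0)//.
    move=> x _; congr EFin; apply/eqP; rewrite eq_le trunc_ge0// andbT.
    exact: le_trans M0.
  exists (sup E) => //; split => // s s1.
  have e0 : (0 < (1 - s) * sup E)%R by rewrite mulr_gt0// subr_gt0.
  have [_ [x _ <-]] := sup_adherent e0 supE.
  by rewrite mulrBl mul1r subKr => sx; exists x; rewrite ltr_pdivlMl// mulrC.
have [M M0 [aM Ma]] := supP _ _ _ a0 A0 Ai.
have [N N0 [bN Nb]] := supP _ _ _ b0 B0 Bj.
pose L := (M `^ (1 - t) * N `^ t)%R.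
have L0 : (0 < L)%R by rewrite mulr_gt0// powR_gt0.
(* Capping [c] makes it real-valued and costs nothing: the levels compared with it below are [L * s]
   with [s < 1]. *)
pose c' x := fine (mine (c x) L%:E).
have c'E x : (c' x)%:E = mine (c x) L%:E.
  rewrite fineK// ge0_fin_numE ?gt_min ?ltry ?orbT//.
  by rewrite le_min c0 lee_fin/= ltW.
have mc' : measurable_fun [set: R] c'.
  by apply: measurableT_comp => //; exact: measurable_mine.
have c'0 x : (0 <= c' x)%R by rewrite -lee_fin c'E le_min c0 lee_fin/= ltW.
have suppM (f : R -> \bar R) (k : nat) (D : R) x : (D * trunc f k x)%R != 0%R ->
    (- (maxn i j)%:R <= x <= (maxn i j)%:R)%R \/ ~~ (k <= maxn i j)%N.
  have [kij|] := boolP (k <= maxn i j)%N; last by right.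
  rewrite /trunc indicE; have [|xk] := boolP (x \in _); last by rewrite !mulr0 eqxx.
  rewrite inE/= in_itv/= -!ler_norml => xk _; left.
  by rewrite (le_trans xk)// ler_nat.
have := @prekopa_leindler_bounded R t (maxn i j)%:R (fun x => M^-1 * trunc a i x)%R
  (fun x => N^-1 * trunc b j x)%R (fun x => L^-1 * c' x)%R t01.
move=> /(_ _ _ _ _ _ _ _ _ Ma Nb) PL.
have {PL} : (1 - t)%:E * \int[leb]_x (M^-1 * trunc a i x)%:E +
    t%:E * \int[leb]_x (N^-1 * trunc b j x)%:E <= \int[leb]_x (L^-1 * c' x)%:E.
  apply: PL.
  - by apply: measurable_funM => //; exact: measurable_trunc.
  - by apply: measurable_funM => //; exact: measurable_trunc.
  - exact: measurable_funM.
  - move=> x; rewrite mulr_ge0 ?invr_ge0 ?(ltW M0) ?trunc_ge0//=.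
    by rewrite ler_pdivrMl// mulr1.
  - move=> x; rewrite mulr_ge0 ?invr_ge0 ?(ltW N0) ?trunc_ge0//=.
    by rewrite ler_pdivrMl// mulr1.
  - by move=> x; rewrite mulr_ge0 ?invr_ge0 ?(ltW L0).
  - by move=> x /suppM; rewrite leq_maxl; case.
  - by move=> x /suppM; rewrite leq_maxr; case.
  move=> x y s /andP[s0 s1].
  rewrite !ltr_pdivlMl// => sa sb.
  rewrite -lte_fin c'E lt_min lte_fin gtr_pMr// s1 andbT.
  have := abc x y (trunc a i x) (trunc b j y) (trunc_ge0 a0 i x) (trunc_ge0 b0 j y)
    (trunc_le a0 i x) (trunc_le b0 j y).
  apply: lt_le_trans; rewrite lte_fin.
  have -> : (L * s = (M * s) `^ (1 - t) * (N * s) `^ t)%R.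
    rewrite !powRM ?(ltW M0) ?(ltW N0)// mulrACA -/L; congr (_ * _)%R.
    have [->|sn0] := eqVneq s 0%R; first by rewrite powR0 ?gt_eqF// mul0r.
    by rewrite -powRD ?sn0 ?implybT// subrK powRr1.
  have Ms0 : (0 <= M * s)%R by rewrite mulr_ge0 ?(ltW M0).
  have Ns0 : (0 <= N * s)%R by rewrite mulr_ge0 ?(ltW N0).
  have MA : ((M * s) `^ (1 - t) < trunc a i x `^ (1 - t))%R.
    by apply: gt0_ltr_powR => //; rewrite nnegrE; exact: trunc_ge0.
  have NB : ((N * s) `^ t < trunc b j y `^ t)%R.
    by apply: gt0_ltr_powR => //; rewrite nnegrE; exact: trunc_ge0.
  by apply: ltr_pM => //; exact: powR_ge0.
have intZ (f : R -> R) D : (0 < D)%R -> measurable_fun [set: R] f ->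
    (forall x, (0 <= f x)%R) ->
    \int[leb]_x (D^-1 * f x)%:E = (D^-1)%:E * \int[leb]_x (f x)%:E.
  move=> D0 mf f0; under eq_integral do rewrite EFinM.
  rewrite ge0_integralZl_EFin//; [by move=> x _; rewrite lee_fin|exact/measurable_EFinP|].
  by rewrite invr_ge0 ltW.
rewrite !intZ//; first last.
- by move=> x; exact: trunc_ge0.
- exact: measurable_trunc.
- by move=> x; exact: trunc_ge0.
- exact: measurable_trunc.
move=> PL; apply: (@le_trans _ _ (\int[leb]_x (c' x)%:E)); last first.
  apply: ge0_le_integral => //.
  - by move=> x _; rewrite lee_fin.
  - exact/measurable_EFinP.
  - by move=> x _; rewrite c'E ge_min lexx.
have -> : (A `^ (1 - t) * B `^ t = L * ((M^-1 * A) `^ (1 - t) * (N^-1 * B) `^ t))%R.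
  rewrite /L mulrACA -!powRM ?mulr_ge0 ?invr_ge0 ?ltW//.
  by rewrite !mulrA !divff ?gt_eqF// !mul1r.
rewrite EFinM -lee_pdivlMl//; apply: le_trans PL.
have MA0 : (0 <= M^-1 * A)%R by rewrite mulr_ge0 ?invr_ge0 ?ltW.
have NB0 : (0 <= N^-1 * B)%R by rewrite mulr_ge0 ?invr_ge0 ?ltW.
apply: (@le_trans _ _ ((1 - t) * (M^-1 * A) + t * (N^-1 * B))%:E).
  by rewrite lee_fin powR_AMGM.
have le2 (w D v : R) (I : \bar R) : (0 < w)%R -> (0 < D)%R -> v%:E <= I ->
    (w * (D^-1 * v))%:E <= w%:E * ((D^-1)%:E * I).
  move=> w0 D0 vI; rewrite !EFinM; do 2 (apply: lee_wpmul2l;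
    first by rewrite lee_fin ?invr_ge0 ltW); exact: vI.
by rewrite EFinD; apply: leeD; apply: le2 => //; exact: ltW.
Qed.

End extended_functions.

(** * Prekopa-Leindler in R^n, by induction on the dimension *)

Section lebesgue_rV_space.
Context {R : realType}.
Local Notation leb := (@lebesgue_measure R).
Local Open Scope ereal_scope.

Lemma integral_lebesgue_rVS n (f : 'rV[R]_n.+1 -> \bar R) :
  measurable_fun [set: 'rV[R]_n.+1] f -> (forall x, 0 <= f x) ->
  \int[lebesgue_rV R n.+1]_x f x =
  \int[leb]_s \int[lebesgue_rV R n]_x f (cons_rV (s, x)).
Proof.
move=> mf f0.
have mcons := @measurable_cons_rV R n.
transitivity (\int[leb \x lebesgue_rV R n]_p f (cons_rV p)).
  transitivity (\int[pushforward (leb \x lebesgue_rV R n) (@cons_rV R n)]_x f x).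
    by [].
  by rewrite ge0_integral_pushforward.
have mfc := measurableT_comp mf mcons.
by apply: (@fubini_tonelli1 _ _ _ _ R leb (lebesgue_rV R n) _ mfc) => p /=.
Qed.

Lemma measurable_integral_cons_rV n (f : 'rV[R]_n.+1 -> \bar R) :
  measurable_fun [set: 'rV[R]_n.+1] f -> (forall x, 0 <= f x) ->
  measurable_fun [set: R] (fun s => \int[lebesgue_rV R n]_x f (cons_rV (s, x))).
Proof.
move=> mf f0; have mfc := measurableT_comp mf (@measurable_cons_rV R n).
by apply: (measurable_fun_fubini_tonelli_F _ mfc) => p /=.
Qed.

Lemma cons_rV_affine n (u v s s' : R) (x y : 'rV[R]_n) :
  (u *: cons_rV (s, x) + v *: cons_rV (s', y))%R =
  cons_rV ((u * s + v * s')%R, (u *: x + v *: y)%R).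
Proof.
have E k (M N : 'rV[R]_k) i :
    ((u *: M + v *: N) ord0 i = u * M ord0 i + v * N ord0 i)%R by rewrite !mxE.
apply/rowP => i; rewrite E; case: (unliftP ord0 i) => [j|] ->.
  by rewrite !cons_rVS/= E.
by rewrite !cons_rV0.
Qed.

(** By Tonelli, integrate the last [n] coordinates first. The induction hypothesis on slices says
    that the resulting functions of the first coordinate satisfy the hypothesis of the inequality on
    the line; [geomean_le] allows them to be infinite. *)
Theorem prekopa_leindler_rV n (t : R) (a b c : 'rV[R]_n -> \bar R) :
  (0 < t < 1)%R ->
  measurable_fun [set: 'rV[R]_n] a -> measurable_fun [set: 'rV[R]_n] b ->
  measurable_fun [set: 'rV[R]_n] c ->
  (forall x, 0 <= a x) -> (forall x, 0 <= b x) -> (forall x, 0 <= c x) ->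
  (forall x y, geomean_le t (a x) (b y) (c ((1 - t) *: x + t *: y)%R)) ->
  geomean_le t (\int[lebesgue_rV R n]_x a x) (\int[lebesgue_rV R n]_x b x)
    (\int[lebesgue_rV R n]_x c x).
Proof.
move=> t01; elim: n => [|n IH] in a b c *.
  move=> ma mb mc a0 b0 c0 /(_ 0%R 0%R).
  by rewrite !scaler0 addr0 !integral_dirac// !diracT !mul1e.
move=> ma mb mc a0 b0 c0 abc.
have msec (f : 'rV[R]_n.+1 -> \bar R) s : measurable_fun [set: 'rV[R]_n.+1] f ->
    measurable_fun [set: 'rV[R]_n] (fun x => f (cons_rV (s, x))).
  move=> mf; apply: (measurableT_comp mf).
  apply: (measurableT_comp (@measurable_cons_rV R n)).
  exact: measurable_fun_pair.
rewrite !integral_lebesgue_rVS//.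
apply: prekopa_leindler_line => //.
- exact: measurable_integral_cons_rV.
- exact: measurable_integral_cons_rV.
- exact: measurable_integral_cons_rV.
- by move=> s; exact: integral_ge0.
- by move=> s; exact: integral_ge0.
- by move=> s; exact: integral_ge0.
move=> s s'; apply: IH => //; [exact: msec..|].
by move=> x y; rewrite -cons_rV_affine; exact: abc.
Qed.

End lebesgue_rV_space.

(** * Integration against a measure given by a density *)

Section density.
Local Open Scope ereal_scope.
Context d (T : measurableType d) (R : realType).
Import HBNNSimple.

(** The density is known only through the measure of sets; simple functions and monotone convergence
    extend the formula to integrals. *)
Lemma ge0_integral_density (m nu : {measure set T -> \bar R}) (w : T -> R)
    (f : T -> \bar R) :
  measurable_fun [set: T] w -> (forall x, (0 <= w x)%R) ->
  (forall A, measurable A -> nu A = \int[m]_(x in A) (w x)%:E) ->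
  measurable_fun [set: T] f -> (forall x, 0 <= f x) ->
  \int[nu]_x f x = \int[m]_x (f x * (w x)%:E).
Proof.
move=> mw w0 nuw mf f0.
have mwE : measurable_fun [set: T] (EFin \o w) by exact/measurable_EFinP.
pose f_ := nnsfun_approx measurableT mf.
have nd x : {homo (fun n => f_ n x) : i j / (i <= j)%N >-> (i <= j)%R}.
  by move=> i j ij; exact/lefP/nd_nnsfun_approx.
have cvgf x : (f_ n x)%:E @[n --> \oo] --> f x by exact: cvg_nnsfun_approx.
transitivity (limn (fun n => \int[nu]_x (f_ n x)%:E)).
  rewrite -monotone_convergence//=.
  - by apply: eq_integral => x _; apply/esym/cvg_lim.
  - by move=> n; exact/measurable_EFinP/measurable_funTS.
  - by move=> n x _; rewrite lee_fin.
  - by move=> x _ i j ij; rewrite lee_fin nd.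
transitivity (limn (fun n => \int[m]_x ((f_ n x)%:E * (w x)%:E))); last first.
  rewrite -monotone_convergence//=.
  - by apply: eq_integral => x _; apply/cvg_lim => //; exact: cvgeZr.
  - move=> n; apply: emeasurable_funM => //; exact/measurable_EFinP/measurable_funTS.
  - by move=> n x _; rewrite mule_ge0 ?lee_fin.
  - by move=> x _ i j ij; rewrite lee_wpmul2r ?lee_fin ?nd.
congr (limn _); apply/funext => n.
under [LHS]eq_integral do rewrite fimfunE -fsumEFin//.
rewrite [LHS]ge0_integral_fsum//; last 2 first.
  - by move=> r; exact/measurable_EFinP/measurableT_comp.
  - by move=> r x _; rewrite EFinM nnfun_muleindic_ge0.
under [RHS]eq_integral.
  move=> x xD; rewrite fimfunE -fsumEFin// ge0_mule_fsuml; last first.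
    by move=> r; rewrite EFinM nnfun_muleindic_ge0.
  over.
rewrite [RHS]ge0_integral_fsum//; last 2 first.
  - move=> r; apply: emeasurable_funM => //.
    by apply/measurable_EFinP; do 2 apply/measurableT_comp => //.
  - by move=> r x _; rewrite mule_ge0 ?lee_fin// -lee_fin EFinM nnfun_muleindic_ge0.
apply: eq_fsbigr => r _; rewrite integralZl_indic_nnsfun//.
have mE : measurable (f_ n @^-1` [set r]) by [].
rewrite integral_indic// setIT nuw//.
(* The sum runs over all real [r]; a negative one has empty preimage. *)
have [r0|r0] := ltP r 0%R.
  rewrite preimage_nnfun0// integral_set0 mule0 integral0_eq// => x _.
  by rewrite indicE in_set0 mulr0 mul0e.
rewrite integral_mkcond.
rewrite -ge0_integralZl_EFin//; first last.
- by apply/(measurable_restrictT _ mE); exact: measurable_funTS.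
- by move=> x _; rewrite patchE; case: ifP => _; rewrite ?lee_fin.
apply: eq_integral => x _; rewrite patchE indicE.
by case: ifP => _; rewrite ?mulr1 ?mulr0 ?mul0e ?mule0.
Qed.

End density.

Section convex_measures.
Context {R : realType} (d : nat).
Local Open Scope ereal_scope.

(** The density is log-concave, so multiplying [a], [b] and [c] by it preserves the pointwise
    hypothesis, and the Lebesgue case applies. *)
Theorem convex_measure_prekopa_leindler (mu : {measure set 'rV[R]_d -> \bar R})
    (t : R) (a b c : 'rV[R]_d -> R) :
  convex_measure mu -> (0 < t < 1)%R ->
  measurable_fun [set: 'rV[R]_d] a -> measurable_fun [set: 'rV[R]_d] b ->
  measurable_fun [set: 'rV[R]_d] c ->
  (forall x, (0 <= a x)%R) -> (forall x, (0 <= b x)%R) ->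
  (forall x, (0 <= c x)%R) ->
  (forall x y, (a x `^ (1 - t) * b y `^ t <= c ((1 - t) *: x + t *: y))%R) ->
  geomean_le t (\int[mu]_x (a x)%:E) (\int[mu]_x (b x)%:E)
    (\int[mu]_x (c x)%:E).
Proof.
move=> [V [[VNy Vconv] mV muE]] t01 ma mb mc a0 b0 c0 abc.
have /andP[t0 t1] := t01.
have t1' : (0 < 1 - t)%R by rewrite subr_gt0.
(* Since [fine +oo] is 0, the exponential alone would be 1 where [V] is infinite; the indicator
   restores the value 0. *)
pose w x := (expR (- fine (V x)) * \1_(~` (V @^-1` [set +oo%E])) x)%R.
have w0 x : (0 <= w x)%R by rewrite mulr_ge0// expR_ge0.
have wE x : (w x)%:E = expeR (- V x).
  rewrite /w indicE; case E : (V x) (VNy x) => [v| |]// _.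
    by rewrite mem_set/= ?mulr1// E.
  by rewrite memNset/= ?mulr0//; apply; rewrite E.
have mw : measurable_fun [set: 'rV[R]_d] w.
  apply: measurable_funM.
    apply: measurableT_comp; first exact: measurable_expR.
    apply: measurableT_comp => //.
    exact: measurableT_comp.
  apply: measurable_indic; apply: measurableC.
  by rewrite -[X in measurable X]setTI; apply: mV.
have wconv x y : (w x `^ (1 - t) * w y `^ t <= w ((1 - t) *: x + t *: y)%R)%R.
  case Ex : (V x) (VNy x) => [v| |]// _; last first.
    have -> : w x = 0%R by apply: EFin_inj; rewrite wE Ex.
    by rewrite powR0 ?gt_eqF// mul0r.
  case Ey : (V y) (VNy y) => [v'| |]// _; last first.
    have -> : w y = 0%R by apply: EFin_inj; rewrite wE Ey.
    by rewrite (@powR0 _ t) ?gt_eqF// mulr0.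
  have -> : w x = expR (- v) by apply: EFin_inj; rewrite wE Ex.
  have -> : w y = expR (- v') by apply: EFin_inj; rewrite wE Ey.
  have := Vconv x y t; rewrite (ltW t0) (ltW t1) Ex Ey => /(_ isT) Vz.
  rewrite -lee_fin wE -!expRM -expRD -[X in X <= _]/(expeR _%:E) lee_expeR.
  rewrite -leeN2 oppeK; apply: (le_trans Vz).
  by rewrite -!EFinM -EFinD -EFinN lee_fin le_eqVlt; apply/orP; left; apply/eqP; ring.
have intE (f : 'rV[R]_d -> R) : measurable_fun [set: 'rV[R]_d] f ->
    (forall x, (0 <= f x)%R) ->
    \int[mu]_x (f x)%:E = \int[lebesgue_rV R d]_x (f x * w x)%:E.
  move=> mf f0; under [RHS]eq_integral do rewrite EFinM.
  apply: ge0_integral_density => //.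
  - by move=> A mA; rewrite muE//; apply: eq_integral => x _; rewrite wE.
  - exact/measurable_EFinP.
rewrite !intE//; apply: prekopa_leindler_rV => //.
- by apply/measurable_EFinP; exact: measurable_funM.
- by apply/measurable_EFinP; exact: measurable_funM.
- by apply/measurable_EFinP; exact: measurable_funM.
- by move=> x; rewrite lee_fin mulr_ge0.
- by move=> x; rewrite lee_fin mulr_ge0.
- by move=> x; rewrite lee_fin mulr_ge0.
clearbody w; move=> x y A B A0 B0; rewrite !lee_fin => Aa Bb.
apply: (@le_trans _ _ ((a x * w x) `^ (1 - t) * (b y * w y) `^ t)%R).
  by apply: ler_pM; rewrite ?powR_ge0//; apply: ge0_ler_powR; rewrite ?nnegrE ?mulr_ge0// ltW.
rewrite !powRM// mulrACA; apply: ler_pM; [| |exact: abc|exact: wconv];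
  by rewrite mulr_ge0 ?powR_ge0.
Qed.

End convex_measures.

(** * Measurability of continuous functions on R^n *)

Section continuous_rV.
Context {R : realType} (n : nat).

Lemma rV_norm_le (x : 'rV[R]_n) (e : R) :
  0 <= e -> (forall i, `|x ord0 i| <= e) -> `|x| <= e.
Proof.
move=> e0 xe; have [x0|/mx_norm_neq0[[i j]/= xij]] := eqVneq (mx_norm x) 0.
  by rewrite [leLHS]x0.
by rewrite [leLHS]xij (ord1 i).
Qed.

Lemma rV_coord_le_norm (x : 'rV[R]_n) i : `|x ord0 i| <= `|x|.
Proof.
rewrite [leRHS]mx_normrE.
exact: (le_bigmax _ (fun ij : 'I_1 * 'I_n => `|x ij.1 ij.2|) (ord0, i)).
Qed.

(** The sigma-algebra is generated by coordinates rather than by open sets. Rounding each coordinate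
    down to a multiple of [k.+1%:R^-1] is a map with countably many values and measurable fibres,
    and by continuity [f] is the pointwise limit of its compositions with these roundings. *)
Lemma continuous_rV_measurable (f : 'rV[R]_n -> R) :
  continuous f -> measurable_fun [set: 'rV[R]_n] f.
Proof.
move=> cf.
pose r k (x : 'rV[R]_n) : 'rV[int]_n := \row_i Num.floor (x ord0 i * k.+1%:R).
pose q k (v : 'rV[int]_n) : 'rV[R]_n := \row_i ((v ord0 i)%:~R / k.+1%:R).
apply: (@measurable_fun_cvg _ _ _ _ (fun k x => f (q k (r k x)))).
  move=> k _ Y mY; rewrite setTI.
  rewrite (_ : _ @^-1` _ =
      \bigcup_(v in [set: 'rV[int]_n]) [set x | Y (f (q k v)) /\ r k x = v]); last first.
    by apply/seteqP; split => [x Yx|x [v _ /= [Yv rv]]]; [by exists (r k x)|rewrite rv].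
  apply: countable_bigcupT_measurable => // v.
  have [Yv|Yv] := pselect (Y (f (q k v))); last first.
    by rewrite (_ : [set x | _] = set0)// -subset0 => x [].
  rewrite (_ : [set x | _] = \bigcap_(i in [set: 'I_n])
      [set x : 'rV[R]_n | Num.floor (x ord0 i * k.+1%:R) = v ord0 i]); last first.
    apply/seteqP; split => x /=; first by move=> [_ <-] i _ /=; rewrite mxE.
    by move=> xv; split => //; apply/rowP => i; rewrite mxE xv.
  apply: fin_bigcap_measurable => // i _.
  rewrite (_ : [set x | _] = [set x : 'rV[R]_n | ((v ord0 i)%:~R <= x ord0 i * k.+1%:R)%R] `&`
     [set x : 'rV[R]_n | (x ord0 i * k.+1%:R < (v ord0 i + 1)%:~R)%R]); last first.
    apply/seteqP; split => x /=; first by move/eqP; rewrite floor_eq => /andP.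
    by move=> xv; apply/eqP; rewrite floor_eq; exact/andP.
  have mi : measurable_fun [set: 'rV[R]_n] (fun x : 'rV[R]_n => x ord0 i * k.+1%:R).
    by apply: measurable_funM => //; exact: measurable_coord.
  by apply: measurableI; [exact: measurable_set_ler|exact: measurable_set_ltr].
move=> x _; apply: continuous_cvg; first exact: cf.
apply/cvgrPdist_le => /= e e0.
near=> k; apply: rV_norm_le => [|i]; first exact: ltW.
rewrite !mxE; have k0 : (0 < k.+1%:R :> R) by [].
have /andP[fl fu] := floor_itv (x ord0 i * k.+1%:R).
rewrite intrD in fu.
have -> : x ord0 i - (Num.floor (x ord0 i * k.+1%:R))%:~R / k.+1%:R =
    (x ord0 i * k.+1%:R - (Num.floor (x ord0 i * k.+1%:R))%:~R) * k.+1%:R^-1.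
  by rewrite mulrBl mulfK ?gt_eqF.
rewrite ger0_norm; last by rewrite mulr_ge0 ?subr_ge0 ?invr_ge0.
apply: (@le_trans _ _ (1 * k.+1%:R^-1)).
  by rewrite ler_wpM2r ?invr_ge0// lerBlDl ltW.
rewrite mul1r ltW//; near: k; exact: (near_infty_natSinv_lt (PosNum e0)).
Unshelve. all: by end_near.
Qed.

End continuous_rV.

(** * Local upper gradient of a smooth function *)

Section local_lipschitz.
Context {R : realType} (d : nat).
Implicit Types (f : 'rV[R]_d -> R) (v x z : 'rV[R]_d).

Lemma directional_MVT f v x (c : R) : (forall y, derivable f y v) ->
  exists2 s, `|s| <= `|c| &
    `|f (c *: v + x) - f x| = `|c| * `|'D_v f (s *: v + x)|.
Proof.
move=> df; pose phi (h : R) := f (h *: v + x).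
have dq (s : R) : (fun h : R => h^-1 *: ((phi \o shift s) (h *: 1) - phi s)) =
    (fun h : R => h^-1 *: ((f \o shift (s *: v + x)) (h *: v) - f (s *: v + x))).
  apply/funext => h /=; rewrite /phi/=; congr (_ *: (f _ - _)).
  by rewrite scalerDl addrA; congr (_ *: v + _ + _); exact: mulr1.
have dphi (s : R) : is_derive s (1 : R) phi ('D_v f (s *: v + x)).
  split; first by rewrite /derivable dq; exact: df.
  by rewrite /derive dq.
have cphi (i : interval R) : {within [set` i], continuous phi}.
  by apply: derivable_within_continuous => s _; have [] := dphi s.
have phi0 : phi 0 = f x by rewrite /phi scale0r add0r.
have [c0|/ltW c0] := leP 0 c.
  have [s] := MVT_segment c0 (fun s _ => dphi s) (cphi `[0, c]).
  rewrite in_itv/= => /andP[s0 sc]; rewrite phi0 subr0 => E.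
  exists s; first by rewrite !ger0_norm.
  by rewrite -/(phi c) E normrM mulrC.
have [s] := MVT_segment c0 (fun s _ => dphi s) (cphi `[c, 0]).
rewrite in_itv/= => /andP[cs s0]; rewrite phi0 sub0r => E.
exists s; first by rewrite !ler0_norm// lerN2.
by rewrite -/(phi c) distrC E normrM mulrC normrN.
Qed.

Lemma compact_rV_ball (K : R) : compact [set x : 'rV[R]_d | `|x| <= K].
Proof.
apply: bounded_closed_compact.
  by exists K; split; [exact: num_real|move=> M KM x /= xK; rewrite (le_trans xK)// ltW].
have -> : [set x : 'rV[R]_d | `|x| <= K] = (fun x : 'rV[R]_d => `|x|) @^-1` [set r : R | r <= K] by [].
by apply: closed_comp => [x _|]; [exact: norm_continuous|exact: closed_le].
Qed.

(** Only [z] is confined to the ball and [x] may leave it, hence the covering form of compactness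
    instead of uniform continuity on the ball. *)
Lemma continuous_unif_rV_ball f (K eta : R) : continuous f -> 0 < eta ->
  exists2 r, 0 < r &
    forall z x, `|z| <= K -> `|x - z| <= r -> `|f x - f z| <= eta.
Proof.
move=> cf eta0; have /compact_near_coveringP cK := @compact_rV_ball K.
have := cK R 0^'+ (fun r z => forall x, `|x - z| <= r -> `|f x - f z| <= eta) _.
move=> /(_ _)[].
  move=> z _.
  have /cvgrPdist_le/(_ (eta / 2)) := cf z.
  rewrite divr_gt0// => /(_ isT)/nbhs_ballP[e /= e0 ez].
  exists (ball z (e / 2), [set r : R | r < e / 2]) => /=.
    split; first by apply: nbhsx_ballx; rewrite divr_gt0.
    by apply: nbhs_right_lt; rewrite divr_gt0.
  move=> [y r]/= [zy re] x xy.
  have fy : `|f z - f y| <= eta / 2.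
    by apply: ez; apply: le_ball zy; rewrite ler_pdivrMr// ler_peMr ?ler1n// ltW.
  have fx : `|f z - f x| <= eta / 2.
    apply: ez; rewrite [e]splitr -ball_normE/= -(subrKA y).
    rewrite (le_lt_trans (ler_normD _ _))// ltr_leD//; last first.
      by rewrite distrC (le_trans xy)// ltW.
    by move: zy; rewrite -ball_normE.
  rewrite -(subrKA (f z)) [eta]splitr (le_trans (ler_normD _ _))// lerD//.
  by rewrite distrC.
move=> e /= e0 He; exists (e / 2); first by rewrite divr_gt0.
move=> z x zK; apply: (He (e / 2) _ _ z zK) => /=.
  by rewrite /ball_/= sub0r normrN gtr0_norm ?divr_gt0// ltr_pdivrMr// ltr_pMr// ltr1n.
by rewrite divr_gt0.
Qed.

Lemma norm_partial_le f i x : `|partial i f x| <= eucl_norm (gradient f x).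
Proof.
rewrite /eucl_norm -[leLHS]sqrtr_sqr.
rewrite ler_wsqrtr// (bigD1 i)//= mxE lerDl.
by apply: sumr_ge0 => j _; exact: sqr_ge0.
Qed.

(** Go from [z] to [x] changing one coordinate at a time and use the mean value theorem on each
    segment. In the sup norm all points met stay within [|x - z|] of [z], so the partial derivatives
    there are close to those at [z]. Each of the [d] steps costs at most the Euclidean norm of the
    gradient. *)
Lemma Ck1_local_lipschitz f (K eta : R) : Ck 1 f -> 0 < eta ->
  exists2 r, 0 < r & forall z x, `|z| <= K -> `|x - z| <= r ->
    `|f x - f z| <= `|x - z| * (d%:R * eucl_norm (gradient f z) + eta).
Proof.
(* Dividing by [d.+1] rather than [d] covers dimension 0; the [d] errors still sum to at most
   [eta]. *)
move=> [_ Cf] eta0; pose e := eta / d.+1%:R.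
have e0 : 0 < e by rewrite divr_gt0.
have /choice[rr rrP] (i : 'I_d) : exists r, 0 < r /\ forall z x, `|z| <= K -> `|x - z| <= r ->
    `|partial i f x - partial i f z| <= e.
  have [_ [cpi _]] := Cf i.
  by have [r r0 rP] := continuous_unif_rV_ball K cpi e0; exists r.
pose r := \big[Num.min/1]_i rr i.
have r0 : 0 < r.
  apply: (big_ind (fun y : R => 0 < y)) => // [y1 y2 ? ?|i _]; last by have [] := rrP i.
  by rewrite lt_min; apply/andP.
exists r => // z x zK xz.
pose w k : 'rV[R]_d := \row_i (if (i < k)%N then x ord0 i else z ord0 i).
have wz : w 0%N = z by apply/rowP => i; rewrite mxE.
have wx : w d = x by apply/rowP => i; rewrite mxE ltn_ord.
have step (i : 'I_d) : `|f (w i.+1) - f (w i)| <=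
    `|x - z| * (eucl_norm (gradient f z) + e).
  pose v : 'rV[R]_d := delta_mx ord0 i.
  have wS : w i.+1 = (x - z) ord0 i *: v + w i.
    apply/rowP => j; rewrite !mxE eqxx/= ltnS leq_eqVlt.
    have [/eqP ->|ji] := boolP (j == i); first by rewrite eqxx ltnn mulr1 subrK.
    by rewrite (negbTE (_ : val j != val i))//= mulr0 add0r.
  have [dfi _] := Cf i; have [s sx] := directional_MVT (w i) ((x - z) ord0 i) dfi.
  rewrite -wS => ->; apply: ler_pM => //; first exact: rV_coord_le_norm.
  have sz : `|s *: v + w i - z| <= r.
    apply: le_trans xz; apply: rV_norm_le => // j; rewrite !mxE eqxx/=.
    have [/eqP ->|ji] := boolP (j == i).
      rewrite ltnn mulr1 addrK (le_trans sx)//; exact: rV_coord_le_norm.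
    rewrite mulr0 add0r; case: ifP => _; last by rewrite subrr normr0.
    by have := rV_coord_le_norm (x - z) j; rewrite !mxE.
  have [_ /(_ _ _ zK)] := rrP i => /(_ (s *: v + w i)) H.
  rewrite -['D_v f _](subrK (partial i f z)) addrC (le_trans (ler_normD _ _))// lerD//.
    exact: norm_partial_le.
  apply: H; apply: le_trans sz _; exact: bigmin_le_cond.
have -> : f x - f z = \sum_(i < d) (f (w i.+1) - f (w i)).
  rewrite -[in LHS]wx -[in LHS]wz -(telescope_sumr (fun k => f (w k)) (leq0n d)).
  by rewrite big_mkord.
rewrite (le_trans (ler_norm_sum _ _ _))//.
rewrite (le_trans (ler_sum _ (fun i _ => step i)))//.
rewrite sumr_const card_ord -[leLHS]mulr_natl mulrCA ler_wpM2l// mulrDr lerD2l.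
rewrite /e mulrA ler_pdivrMr// mulrC ler_pM2l// ler_nat.
exact: leqnSn.
Qed.

End local_lipschitz.

(** * Supremal convolution *)

Section scalar_inequalities.
Context {R : realType}.
Implicit Types a q l b x y g m s k : R.

(** Convexity of the power function at [a / (1 - l)] and [q / l], whose weighted mean is [a + q].
    The free weight [l] is what allows the coefficient of [a] to be close to 1. *)
Lemma powR_add_le a q l b : 0 <= a -> 0 <= q -> 0 < l < 1 -> 1 <= b ->
  (a + q) `^ b <= (1 - l) `^ (1 - b) * a `^ b + l `^ (1 - b) * q `^ b.
Proof.
move=> a0 q0 /andP[l0 l1] b1.
have l0' : 0 < 1 - l by rewrite subr_gt0.
have ql0 : 0 <= q / l by rewrite divr_ge0// ltW.
have al0 : 0 <= a / (1 - l) by rewrite divr_ge0// ltW.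
have := @convex_powR R b b1 (Itv01 (ltW l0) (ltW l1)) (q / l) (a / (1 - l)).
rewrite !inE/= !in_itv/= !andbT => /(_ ql0 al0) h.
rewrite convRE [X in X `^ _ <= _]convRE/= /unstable.onem in h.
rewrite [l * (_ / _)]mulrC divfK ?gt_eqF// in h.
rewrite [(1 - l) * (_ / _)]mulrC divfK ?gt_eqF// in h.
rewrite addrC; apply: (le_trans h); rewrite addrC.
have E c u : 0 < c -> 0 <= u -> c * (u / c) `^ b = c `^ (1 - b) * u `^ b.
  move=> c0 u0; rewrite powRM ?invr_ge0 ?(ltW c0)// -powR_inv1 ?(ltW c0)//.
  rewrite -powRrM mulN1r mulrCA mulrC; congr (_ * _).
  rewrite powRB; last by rewrite (gt_eqF c0) implybT.
  by rewrite powRr1 ?powRN// ltW.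
by rewrite !E.
Qed.

Lemma powR_add_le2 a q b : 0 <= a -> 0 <= q -> 1 <= b ->
  (a + q) `^ b <= 2 `^ (b - 1) * (a `^ b + q `^ b).
Proof.
move=> a0 q0 b1; have := @powR_add_le a q 2^-1 b a0 q0 _ b1.
rewrite invr_gt0 ltr0n invf_lt1// ltr1n => /(_ isT).
have -> : 1 - 2^-1 = 2^-1 :> R by lra.
by rewrite -[X in X `^ (1 - b)]powR_inv1// -powRrM mulN1r opprB -mulrDr.
Qed.

Lemma expR_le1D2 x : 0 <= x <= 2^-1 -> expR x <= 1 + 2 * x.
Proof.
move=> /andP[x0 x1]; have := @expR_ge1Dx R (- x); rewrite expRN => h.
have e0 := expR_gt0 x.
have : (1 - x) * expR x <= 1 by rewrite -ler_pdivlMr// mul1r.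
nra.
Qed.

(* The Legendre duality between [x ln x - x] and [exp]. *)
Lemma mul_le_entropy_expR g m y : 0 <= g -> 0 < m ->
  g * y <= g * ln (g / m) - g + m * expR y.
Proof.
rewrite le_eqVlt => /predU1P[<-|g0] m0.
  by rewrite !mul0r subrr add0r mulr_ge0 ?expR_ge0// ltW.
have gm0 : 0 < g / m by rewrite divr_gt0.
have := @expR_ge1Dx R (y - ln (g / m)).
rewrite expRB lnK ?posrE// invf_div mulrA => h.
have {h} := ler_wpM2l (ltW g0) h.
have -> : g * (expR y * m / g) = m * expR y by field; rewrite gt_eqF.
lra.
Qed.

(** Factor [g]^ (1 + s)[as]m [^ s * expR (s * k) * g * expR (s * (ln (g / m) - k))] and bound the
    last exponential by its tangent at 0. If [m] is the integral of [g] and [k * m] its entropy, the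
    term in [s] integrates to 0, as in Jensen's inequality. *)
Lemma powR_tangent_le g m s k : 0 <= g -> 0 < m -> 0 < s ->
  m `^ s * expR (s * k) * (g + s * (g * ln (g / m) - k * g)) <= g `^ (1 + s).
Proof.
rewrite le_eqVlt => /predU1P[<-|g0] m0 s0.
  by rewrite !mul0r mulr0 subr0 mulr0 addr0 mulr0 powR_ge0.
have gm0 : 0 < g / m by rewrite divr_gt0.
have -> : g `^ (1 + s) = m `^ s * expR (s * k) * (g * expR (s * (ln (g / m) - k))).
  rewrite powRD; last by rewrite (gt_eqF g0) implybT.
  rewrite powRr1 ?(ltW g0)//.
  have -> : g `^ s = m `^ s * expR (s * ln (g / m)).
    rewrite mulrC [s * _]mulrC expRM lnK ?posrE// -powRM ?(ltW gm0) ?(ltW m0)//.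
    by rewrite divfK ?gt_eqF.
  by rewrite mulrBr expRB; field; rewrite gt_eqF ?expR_gt0.
rewrite ler_wpM2l ?mulr_ge0 ?powR_ge0 ?expR_ge0//.
have := ler_wpM2l (ltW g0) (@expR_ge1Dx R (s * (ln (g / m) - k))).
lra.
Qed.

End scalar_inequalities.

Section supremal_convolution.
Context {R : realType}.
Variables alpha beta delta : R.
Hypotheses (alpha_gt1 : 1 < alpha) (betaE : beta = alpha / (alpha - 1)).
Hypothesis (delta_gt0 : 0 < delta).

Let alpha1 : 0 < alpha - 1. Proof. by rewrite subr_gt0. Qed.

Let alpha0 : 0 < alpha. Proof. exact: lt_trans alpha_gt1. Qed.

Let betaB1 : beta - 1 = (alpha - 1)^-1.
Proof. by rewrite betaE; field; rewrite gt_eqF. Qed.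

Lemma conjugate_gt1 : 1 < beta.
Proof. by rewrite -subr_gt0 betaB1 invr_gt0. Qed.

Let beta1 := conjugate_gt1.

Let alphaM : alpha * (beta - 1) = beta.
Proof. by rewrite betaB1 betaE. Qed.

Definition split_rate : R := delta * 2 `^ (- alpha) / (beta - 1).

Lemma split_rate_gt0 : 0 < split_rate.
Proof. by rewrite divr_gt0 ?mulr_gt0 ?powR_gt0 ?subr_gt0. Qed.

(** The first factor comes from [t / (1 - t) <= 2 * t], the second from the weight raised to
    [1 - beta]. *)
Definition gradient_cst : R := 2 `^ beta * split_rate `^ (1 - beta).

Lemma gradient_cst_gt0 : 0 < gradient_cst.
Proof. by rewrite mulr_gt0 ?powR_gt0 ?split_rate_gt0. Qed.

(* [powR_add_le] is applied with the weight [l] below, which makes the loss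
   [(1 - l) `^ (1 - beta)] absorbable in [expR (- t * delta * N `^ alpha)] and
   cancels the growth [p `^ beta = (p `^ alpha) `^ (beta - 1)] of the second
   term. *)
Lemma supremal_convolution_le t F F' N Z p L :
  0 < t <= 2^-1 -> 0 <= F -> 0 <= F' -> 0 <= N -> 0 <= Z -> 0 <= p -> 0 <= L ->
  p <= N + Z -> F' <= F + t / (1 - t) * p * L ->
  split_rate * t * (1 + p `^ alpha) <= 2^-1 ->
  F' `^ beta * expR (- (t * (delta * N `^ alpha))) <=
  expR (t * (delta * (1 + Z `^ alpha))) * F `^ beta +
  gradient_cst * t * L `^ beta.
Proof.
move=> /andP[t0 t2] F0 F'0 N0 Z0 p0 L0 pNZ F'F.
have [kappa kappaE] : exists k, k = split_rate by exists split_rate.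
have kappa0 : 0 < kappa by rewrite kappaE split_rate_gt0.
rewrite -kappaE; set l := _ * _ * _ => l2.
have pa1 : 0 < 1 + p `^ alpha by rewrite ltr_pwDl ?powR_ge0.
have l0 : 0 < l by apply: mulr_gt0 => //; exact: mulr_gt0.
have l1 : l < 1 by rewrite (le_lt_trans l2)// invf_lt1// ltr1n.
have t1 : 0 < 1 - t by lra.
have b1 : 0 < beta - 1 by rewrite subr_gt0.
have b0 : 0 < beta by exact: lt_trans beta1.
set q := t / (1 - t) * p * L in F'F.
have q0 : 0 <= q by rewrite /q !mulr_ge0 ?invr_ge0// ltW.
have tt2 : t / (1 - t) <= 2 * t.
  by rewrite ler_pdivrMr//; nra.
have H1 : F' `^ beta <= (1 - l) `^ (1 - beta) * F `^ beta + l `^ (1 - beta) * q `^ beta.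
  apply: le_trans (powR_add_le F0 q0 _ (ltW beta1)); last by rewrite l0.
  by apply: ge0_ler_powR => //; rewrite ?nnegrE ?addr_ge0// ltW.
have H2 : (1 - l) `^ (1 - beta) <= expR (2 * l * (beta - 1)).
  have l1' : 0 < 1 - l by rewrite subr_gt0.
  have -> : 1 - beta = -1 * (beta - 1) by rewrite mulN1r opprB.
  rewrite powRrM powR_inv1 ?(ltW l1')// expRM; apply: ge0_ler_powR.
  - exact: ltW.
  - by rewrite nnegrE invr_ge0 ltW.
  - by rewrite nnegrE expR_ge0.
  apply: (@le_trans _ _ (1 + 2 * l)); last exact: expR_ge1Dx.
  by rewrite -[leLHS]mul1r ler_pdivrMr//; nra.
have H3 : 2 * l * (beta - 1) <= t * (delta * (1 + N `^ alpha + Z `^ alpha)).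
  have pa : p `^ alpha <= 2 `^ (alpha - 1) * (N `^ alpha + Z `^ alpha).
    apply: le_trans (powR_add_le2 N0 Z0 (ltW alpha_gt1)).
    by apply: ge0_ler_powR => //; rewrite ?nnegrE ?addr_ge0// ltW.
  have E1 : 2 * 2 `^ (- alpha) * 2 `^ (alpha - 1) = 1 :> R.
    rewrite -mulrA -powRD; last by rewrite pnatr_eq0 implybT.
    by rewrite addrA addNr sub0r powR_inv1// divff.
  have E2 : 2 * 2 `^ (- alpha) <= 1 :> R.
    rewrite -[leRHS](@divff _ (2 : R))// ler_pM2l// -powR_inv1//.
    by rewrite ler_powR ?ler1n// lerN2 ltW.
  have -> : 2 * l * (beta - 1) = t * (delta * (2 * 2 `^ (- alpha) * (1 + p `^ alpha))).
    by rewrite /l kappaE /split_rate; field; rewrite gt_eqF.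
  rewrite ler_pM2l// ler_pM2l// mulrDr mulr1 -addrA lerD//.
  apply: (@le_trans _ _ (2 * 2 `^ (- alpha) * (2 `^ (alpha - 1) * (N `^ alpha + Z `^ alpha)))).
    by rewrite ler_wpM2l// mulr_ge0 ?powR_ge0.
  by rewrite mulrA E1 mul1r.
have GL0 : 0 <= gradient_cst * t * L `^ beta.
  apply: mulr_ge0; last exact: powR_ge0.
  by apply: mulr_ge0; apply: ltW => //; exact: gradient_cst_gt0.
have H4 : l `^ (1 - beta) * q `^ beta <= gradient_cst * t * L `^ beta.
  have q2 : q `^ beta <= (2 * t * p * L) `^ beta.
    apply: ge0_ler_powR; rewrite ?nnegrE ?(ltW b0)//.
      by rewrite !mulr_ge0 ?(ltW t0).
    by rewrite /q; do 2 apply: ler_wpM2r => //.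
  apply: (@le_trans _ _ (l `^ (1 - beta) * (2 * t * p * L) `^ beta)).
    by rewrite ler_wpM2l ?powR_ge0.
  rewrite /l !powRM ?mulr_ge0 ?(ltW t0) ?(ltW kappa0) ?(ltW pa1)//.
  have E1 : t `^ (1 - beta) * t `^ beta = t.
    rewrite -powRD; last by rewrite (gt_eqF t0) implybT.
    by rewrite subrK powRr1// ltW.
  have E2 : p `^ beta * (1 + p `^ alpha) `^ (1 - beta) <= 1.
    have -> : 1 - beta = - (beta - 1) by rewrite opprB.
    rewrite -{1}alphaM powRrM powRN ler_pdivrMr ?powR_gt0// mul1r.
    apply: ge0_ler_powR; rewrite ?nnegrE ?powR_ge0 ?ltW//.
    by rewrite ltrDr.
  have -> : kappa `^ (1 - beta) * t `^ (1 - beta) * (1 + p `^ alpha) `^ (1 - beta) *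
      (2 `^ beta * t `^ beta * p `^ beta * L `^ beta) =
    gradient_cst * t * L `^ beta * (p `^ beta * (1 + p `^ alpha) `^ (1 - beta)).
    by rewrite -[in RHS]E1 /gradient_cst -kappaE; ring.
  by rewrite -[leRHS]mulr1 ler_wpM2l.
set A := expR (- _).
have A0 : 0 < A := expR_gt0 _.
have A1 : A <= 1.
  by rewrite /A -expR0 ler_expR oppr_le0 !mulr_ge0 ?powR_ge0 ?ltW.
apply: (@le_trans _ _ ((expR (2 * l * (beta - 1)) * F `^ beta + gradient_cst * t * L `^ beta) * A)).
  rewrite ler_wpM2r ?(ltW A0)//; apply: (le_trans H1); rewrite lerD//.
  by rewrite ler_wpM2r ?powR_ge0.
rewrite mulrDl lerD//; last first.
  by rewrite -[leRHS]mulr1 ler_wpM2l.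
rewrite mulrAC ler_wpM2r ?powR_ge0// /A -expRD ler_expR.
move: H3; rewrite !mulrDr; lra.
Qed.

End supremal_convolution.

(** * Defective logarithmic Sobolev inequality on balls *)

Section locally_bounded.
Context {R : realType} (d : nat).
Implicit Types f g : 'rV[R]_d -> R.

Definition rV_ball (K : R) : set 'rV[R]_d := [set x | `|x| <= K].

(** Such functions are integrable on every ball for any probability measure, and the class is stable
    under the sums, products, powers, exponentials and entropy integrands formed below. *)
Definition loc_bounded f : Prop :=
  measurable_fun [set: 'rV[R]_d] f /\
  forall K, exists M, forall x, rV_ball K x -> `|f x| <= M.

Lemma loc_bounded_continuous f : continuous f -> loc_bounded f.
Proof.
move=> cf; split; first exact: continuous_rV_measurable.
move=> K; have cK := @compact_rV_ball R d K.
have cfK : {within rV_ball K, continuous f} by exact: continuous_subspaceT.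
have [M [_ MP]] := compact_bounded (continuous_compact cfK cK).
exists (`|M| + 1) => x xK; apply: (MP (`|M| + 1)); last by exists x.
by rewrite ltr_pwDr// ler_norm.
Qed.

Lemma loc_bounded_cst (c : R) : loc_bounded (fun=> c).
Proof. by split => // K; exists `|c|. Qed.

Lemma loc_boundedD f g : loc_bounded f -> loc_bounded g ->
  loc_bounded (fun x => f x + g x).
Proof.
move=> [mf bf] [mg bg]; split; first exact: measurable_funD.
move=> K; have [M fM] := bf K; have [N gN] := bg K; exists (M + N) => x xK.
by rewrite (le_trans (ler_normD _ _))// lerD// ?fM// gN.
Qed.

Lemma loc_boundedM f g : loc_bounded f -> loc_bounded g ->
  loc_bounded (fun x => f x * g x).
Proof.
move=> [mf bf] [mg bg]; split; first exact: measurable_funM.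
move=> K; have [M fM] := bf K; have [N gN] := bg K; exists (M * N) => x xK.
by rewrite normrM ler_pM// ?fM// gN.
Qed.

Lemma loc_boundedN f : loc_bounded f -> loc_bounded (fun x => - f x).
Proof.
move=> [mf bf]; split; first exact: measurableT_comp.
by move=> K; have [M fM] := bf K; exists M => x xK; rewrite normrN fM.
Qed.

Lemma loc_bounded_powR f (b : R) : 0 <= b -> (forall x, 0 <= f x) ->
  loc_bounded f -> loc_bounded (fun x => f x `^ b).
Proof.
move=> b0 f0 [mf bf]; split.
  by apply: (measurableT_comp (measurable_powR b)).
move=> K; have [M fM] := bf K; exists (M `^ b) => x xK.
rewrite ger0_norm ?powR_ge0//; have := fM _ xK; rewrite ger0_norm// => fxM.
by apply: ge0_ler_powR; rewrite ?nnegrE// (le_trans _ fxM).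
Qed.

Lemma loc_bounded_expR f : loc_bounded f -> loc_bounded (fun x => expR (f x)).
Proof.
move=> [mf bf]; split; first exact: measurableT_comp.
move=> K; have [M fM] := bf K; exists (expR M) => x xK.
rewrite ger0_norm ?expR_ge0// ler_expR (le_trans (ler_norm _))//; exact: fM.
Qed.

Lemma entropy_integrand_ge (g m : R) : 0 <= g -> 0 < m -> g - m <= g * ln (g / m).
Proof.
move=> g0 m0; have := mul_le_entropy_expR 0 g0 m0; rewrite mulr0 expR0; lra.
Qed.

Lemma entropy_integrand_le (g m : R) : 0 <= g -> 0 < m ->
  g * ln (g / m) <= g * (g / m).
Proof.
rewrite le_eqVlt => /predU1P[<-|g0] m0; first by rewrite !mul0r.
by rewrite ler_pM2l// ltW// ln_sublinear// divr_gt0.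
Qed.

(** The integrand lies between [g - m] and [g * (g / m)], by linear bounds on the logarithm; zeros
    of [g] need no separate treatment. *)
Lemma loc_bounded_entropy g (m : R) : 0 < m -> (forall x, 0 <= g x) ->
  loc_bounded g -> loc_bounded (fun x => g x * ln (g x / m)).
Proof.
move=> m0 g0 [mg bg]; split.
  apply: measurable_funM => //; apply: measurableT_comp => //.
  exact: measurable_funM.
move=> K; have [M gM] := bg K; exists (m + M * (M / m)) => x xK.
have := gM _ xK; rewrite ger0_norm// => gxM.
have M0 : 0 <= M by rewrite (le_trans _ gxM).
have MM0 : 0 <= M * (M / m) by rewrite !mulr_ge0// invr_ge0 ltW.
rewrite ler_norml; apply/andP; split.
  by apply: le_trans (entropy_integrand_ge (g0 x) m0); have := g0 x; lra.
apply: (le_trans (entropy_integrand_le (g0 x) m0)).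
apply: (@le_trans _ _ (M * (M / m))); last by lra.
by rewrite ler_pM// ?mulr_ge0 ?invr_ge0 ?(ltW m0)// ler_wpM2r// invr_ge0 ltW.
Qed.

Lemma loc_bounded_norm_powR (b : R) : 0 <= b ->
  loc_bounded (fun x : 'rV[R]_d => `|x| `^ b).
Proof.
move=> b0; apply: loc_bounded_powR => //; apply: loc_bounded_continuous.
exact: norm_continuous.
Qed.

Lemma measurable_rV_ball K : measurable (rV_ball K).
Proof.
apply: measurable_set_ler => //; have [] := @loc_bounded_continuous (fun x => `|x|) => //.
exact: norm_continuous.
Qed.

Lemma rV_ball_convex K (t : R) x y : 0 <= t <= 1 -> rV_ball K x -> rV_ball K y ->
  rV_ball K ((1 - t) *: x + t *: y).
Proof.
move=> /andP[t0 t1] xK yK; rewrite /rV_ball/= (le_trans (ler_normD _ _))//.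
rewrite !normrZ ger0_norm ?subr_ge0// ger0_norm//.
have -> : K = (1 - t) * K + t * K by rewrite -mulrDl subrK mul1r.
by rewrite lerD// ler_wpM2l// subr_ge0.
Qed.

End locally_bounded.

(** * Integration and Prekopa-Leindler on a ball *)

Section integral_ball.
Context {R : realType} (d : nat) (mu : probability 'rV[R]_d R).
Implicit Types f g : 'rV[R]_d -> R.
Variable K : R.
Local Notation B := (@rV_ball R d K).

Lemma integrable_rV_ball f : loc_bounded f -> mu.-integrable B (EFin \o f).
Proof.
move=> [mf bf]; apply: measurable_bounded_integrable.
- exact: measurable_rV_ball.
- by rewrite (le_lt_trans (probability_le1 mu (measurable_rV_ball K)))// ltry.
- exact: measurable_funTS.
have [M fM] := bf K; exists M; split; first exact: num_real.
by move=> N MN x xK; rewrite /= (le_trans (fM _ xK))// ltW.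
Qed.

Lemma RintegralD_ball f g : loc_bounded f -> loc_bounded g ->
  (\int[mu]_(x in B) (f x + g x) =
   \int[mu]_(x in B) f x + \int[mu]_(x in B) g x)%R.
Proof.
move=> lf lg; apply: RintegralD; [exact: measurable_rV_ball|exact: integrable_rV_ball..].
Qed.

Lemma RintegralZ_ball f c : loc_bounded f ->
  (\int[mu]_(x in B) (c * f x) = c * \int[mu]_(x in B) f x)%R.
Proof.
move=> lf; apply: RintegralZl; [exact: measurable_rV_ball|exact: integrable_rV_ball].
Qed.

Lemma le_Rintegral_ball f g : loc_bounded f -> loc_bounded g ->
  (forall x, B x -> f x <= g x) ->
  (\int[mu]_(x in B) f x <= \int[mu]_(x in B) g x)%R.
Proof.
move=> lf lg fg; apply: le_Rintegral => //; [exact: measurable_rV_ball|exact: integrable_rV_ball..].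
Qed.

Lemma EFin_Rintegral_ball f : loc_bounded f ->
  (\int[mu]_(x in B) f x)%R%:E = (\int[mu]_(x in B) (f x)%:E)%E.
Proof.
move=> lf; rewrite fineK//; apply: integrable_fin_num; first exact: measurable_rV_ball.
exact: integrable_rV_ball.
Qed.

(** Multiply the three functions by the indicator of the ball; the ball is convex, so the indicator
    attached to [c] equals 1 wherever the other two do. *)
Lemma prekopa_leindler_ball (t : R) (a b c : 'rV[R]_d -> R) (A A' : R) :
  convex_measure mu -> 0 < t < 1 ->
  loc_bounded a -> loc_bounded b -> loc_bounded c ->
  (forall x, 0 <= a x) -> (forall x, 0 <= b x) -> (forall x, 0 <= c x) ->
  (forall x y, B x -> B y -> a x `^ (1 - t) * b y `^ t <= c ((1 - t) *: x + t *: y)) ->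
  0 <= A -> 0 <= A' ->
  A <= (\int[mu]_(x in B) a x)%R -> A' <= (\int[mu]_(x in B) b x)%R ->
  A `^ (1 - t) * A' `^ t <= (\int[mu]_(x in B) c x)%R.
Proof.
move=> mu_convex t01 la lb lc a0 b0 c0 abc A0 A'0 Aa A'b.
have /andP[t0 t1] := t01.
have mB := @measurable_rV_ball R d K.
have intE f : loc_bounded f -> (\int[mu]_(x in B) f x)%R%:E =
    (\int[mu]_x (f x * \1_B x)%:E)%E.
  move=> lf; rewrite EFin_Rintegral_ball// [LHS]integral_mkcond.
  apply: eq_integral => x _; rewrite patchE indicE.
  by case: ifP; rewrite ?mulr1 ?mulr0.
rewrite -lee_fin intE//.
apply: (@convex_measure_prekopa_leindler _ _ mu t (fun x => a x * \1_B x)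
  (fun x => b x * \1_B x)) => //.
- by apply: measurable_funM => //; case: la.
- by apply: measurable_funM => //; case: lb.
- by apply: measurable_funM => //; case: lc.
- by move=> x; rewrite mulr_ge0.
- by move=> x; rewrite mulr_ge0.
- by move=> x; rewrite mulr_ge0.
- move=> x y; rewrite !indicE.
  case: (boolP (x \in B)) => [|_]; last first.
    by rewrite mulr0 powR0 ?mul0r ?mulr_ge0// gt_eqF// subr_gt0.
  case: (boolP (y \in B)) => [|_]; last first.
    by rewrite mulr0 (@powR0 _ t) ?mulr0 ?mulr_ge0// gt_eqF.
  rewrite !inE => yB xB; rewrite mem_set/=; last first.
    by apply: rV_ball_convex => //; rewrite !ltW.
  by rewrite !mulr1 abc.
- by rewrite -intE// lee_fin.
- by rewrite -intE// lee_fin.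
Qed.

End integral_ball.

Section defective_log_sobolev.
Context {R : realType} (d : nat) (mu : probability 'rV[R]_d R).
Variables alpha beta : R.
Hypotheses (mu_convex : convex_measure mu) (alpha_gt1 : 1 < alpha)
  (betaE : beta = alpha / (alpha - 1)).
Local Notation B := (@rV_ball R d).

Let beta1 : 1 < beta. Proof. exact: conjugate_gt1 alpha_gt1 betaE. Qed.

(** The bound is one-sided and has a slack [eta], a form inherited by positive parts; [r] is uniform
    in [z] over the ball, while [x] need not stay in it. *)
Definition local_upper_gradient (F G : 'rV[R]_d -> R) : Prop :=
  forall K eta, 0 < eta -> exists2 r, 0 < r & forall z x, B K z -> `|x - z| <= r ->
    F x <= F z + `|x - z| * (G z + eta).

(** Here [n] and [eta] are fixed; [t] depends on them but disappears in the final division. The mass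
    of the Gaussian-like function enters only through its lower bound [v0]. *)
Lemma entropy_ball_le (delta n v0 eta : R) (F G : 'rV[R]_d -> R) :
  0 < delta -> 0 < n -> 0 < v0 -> 0 < eta ->
  v0 <= (\int[mu]_(x in B n) expR (- (delta * `|x| `^ alpha)))%R ->
  loc_bounded F -> loc_bounded G -> (forall x, 0 <= F x) -> (forall x, 0 <= G x) ->
  local_upper_gradient F G ->
  let m := (\int[mu]_(x in B n) (F x `^ beta))%R in 0 < m ->
  (\int[mu]_(x in B n) (F x `^ beta * ln (F x `^ beta / m)) <=
   m * - ln v0 +
   2 * delta * (m + \int[mu]_(x in B n) (`|x| `^ alpha * F x `^ beta)) +
   gradient_cst alpha beta delta *
     \int[mu]_(x in B n) ((G x + eta) `^ beta))%R.
Proof.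
move=> delta0 n0 v00 eta0 v0b lF lG F0 G0 FG m m0.
have beta0 : 0 < beta by exact: lt_trans beta1.
have alpha0 : 0 < alpha by exact: lt_trans alpha_gt1.
have [r r0 FGr] := FG n eta eta0.
have [kappa kappaE] : exists k, k = split_rate alpha beta delta by eexists.
have kappa0 : 0 < kappa by rewrite kappaE; exact: split_rate_gt0.
have [C CE] : exists C, C = gradient_cst alpha beta delta by eexists.
have C0 : 0 < C by rewrite CE; exact: gradient_cst_gt0.
rewrite -CE.
(* The four summands give, in order: [t <= 2^-1]; a displacement [|x - z|] of at most [r]; a
   splitting weight of at most [2^-1]; and exponents small enough for [expR_le1D2]. *)
pose D := 2 + 4 * n / r + 2 * kappa * (1 + (2 * n) `^ alpha) +
  2 * delta * (1 + n `^ alpha).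
have P1 : 0 <= 4 * n / r by rewrite !mulr_ge0 ?invr_ge0// ltW.
have P2 : 0 <= 2 * kappa * (1 + (2 * n) `^ alpha).
  by rewrite !mulr_ge0 ?addr_ge0 ?powR_ge0// ltW.
have P3 : 0 <= 2 * delta * (1 + n `^ alpha).
  by rewrite !mulr_ge0 ?addr_ge0 ?powR_ge0// ltW.
have D0 : 0 < D by rewrite /D; lra.
pose t := D^-1.
have t0 : 0 < t by rewrite invr_gt0.
have tD : t * D = 1 by rewrite mulVf// gt_eqF.
have T0 : t <= 2^-1 by move: tD; rewrite /D; nra.
have T1 : t * (4 * n / r) <= 1 by move: tD; rewrite /D; nra.
have T2 : t * (2 * kappa * (1 + (2 * n) `^ alpha)) <= 1 by move: tD; rewrite /D; nra.
have T3 : t * (2 * delta * (1 + n `^ alpha)) <= 1 by move: tD; rewrite /D; nra.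
clearbody t; clear tD D0 D P1 P2 P3.
have t1' : 0 < 1 - t by lra.
(* [1 + s] is the inverse of [1 - t], and [s] is also the ratio in [x - z = s *: (z - y)]. *)
pose s := t / (1 - t).
have s0 : 0 < s by rewrite divr_gt0.
have s2t : s <= 2 * t by rewrite ler_pdivrMr//; nra.
have sE : (1 + s) * (1 - t) = 1 by rewrite /s; field; rewrite gt_eqF.
have sE' : s * (1 - t) = t by rewrite /s divfK// gt_eqF.
pose g x := F x `^ beta.
have g0 x : 0 <= g x by exact: powR_ge0.
have lg : loc_bounded g by apply: loc_bounded_powR => //; exact: ltW.
have lZ : loc_bounded (fun x : 'rV[R]_d => `|x| `^ alpha).
  by apply: loc_bounded_norm_powR; exact: ltW.
have lGe : loc_bounded (fun x => (G x + eta) `^ beta).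
  apply: loc_bounded_powR; [exact: ltW|by move=> x; rewrite addr_ge0// ltW|].
  by apply: loc_boundedD => //; exact: loc_bounded_cst.
have lent : loc_bounded (fun x => g x * ln (g x / m)) by exact: loc_bounded_entropy.
set E := Rintegral _ _ _; set Y := Rintegral _ _ _; set I := Rintegral _ _ _.
(* The mean of [ln (g / m)] under the probability with density [g / m], which kills the first-order
   term of [powR_tangent_le] after integration. *)
pose k := E / m.
pose a x := g x `^ (1 + s).
pose b (x : 'rV[R]_d) := expR (- (delta * `|x| `^ alpha)).
pose c x := expR (t * (delta * (1 + `|x| `^ alpha))) * g x + C * t * (G x + eta) `^ beta.
have la : loc_bounded a by apply: loc_bounded_powR => //; rewrite addr_ge0// ltW.
have lb : loc_bounded b.
  apply/loc_bounded_expR/loc_boundedN/loc_boundedM => //; exact: loc_bounded_cst.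
have lc : loc_bounded c.
  apply: loc_boundedD; apply: loc_boundedM => //.
  - apply: loc_bounded_expR; apply: loc_boundedM; first exact: loc_bounded_cst.
    apply: loc_boundedM; first exact: loc_bounded_cst.
    by apply: loc_boundedD => //; exact: loc_bounded_cst.
  - exact: loc_bounded_cst.
have abc x y : B n x -> B n y ->
    a x `^ (1 - t) * b y `^ t <= c ((1 - t) *: x + t *: y).
  move=> xn yn; set z := (1 - t) *: x + t *: y.
  have zn : B n z by apply: rV_ball_convex => //; rewrite (ltW t0)/=; lra.
  have xz : x - z = s *: (z - y).
    by apply/rowP => i; rewrite !mxE /s; field; rewrite gt_eqF.
  have xzE : `|x - z| = s * `|z - y| by rewrite xz normrZ gtr0_norm.
  have zy2n : `|z - y| <= 2 * n.
    rewrite (le_trans (ler_normB _ _))//; move: zn yn; rewrite /rV_ball/=; lra.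
  have xzr : `|x - z| <= r.
    rewrite xzE; apply: (@le_trans _ _ (2 * t * (2 * n))); first by rewrite ler_pM// ltW.
    by move: T1; rewrite mulrA ler_pdivrMr//; lra.
  rewrite /a /b -powRrM sE powRr1// -expRM mulNr [X in - X]mulrC.
  rewrite /c CE; apply: (@supremal_convolution_le R alpha beta delta _ _ _ t (F z) (F x) `|y| `|z| `|z - y|) => //.
  - by rewrite t0.
  - by rewrite addr_ge0// ltW.
  - by rewrite [leRHS]addrC ler_normB.
  - by have := FGr z x zn xzr; rewrite xzE.
  rewrite -kappaE; apply: (@le_trans _ _ (t * kappa * (1 + (2 * n) `^ alpha))).
    rewrite [_ * t]mulrC ler_wpM2l ?mulr_ge0 ?(ltW t0) ?(ltW kappa0)//.
    by rewrite lerD2l; apply: ge0_ler_powR => //; rewrite ?nnegrE ?mulr_ge0// ltW.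
  by move: T2; lra.
pose A := m `^ (1 + s) * expR (s * k).
have km : k * m = E by rewrite divfK// gt_eqF.
have lkg : loc_bounded (fun x => - k * g x).
  by apply: loc_boundedM => //; exact: loc_bounded_cst.
have lekg : loc_bounded (fun x => g x * ln (g x / m) + - k * g x) by exact: loc_boundedD.
have lsekg : loc_bounded (fun x => s * (g x * ln (g x / m) + - k * g x)).
  by apply: loc_boundedM => //; exact: loc_bounded_cst.
have lgsekg : loc_bounded (fun x => g x + s * (g x * ln (g x / m) + - k * g x)).
  exact: loc_boundedD.
have Aa : A <= (\int[mu]_(x in B n) a x)%R.
  have -> : A = (\int[mu]_(x in B n) (m `^ s * expR (s * k) *
      (g x + s * (g x * ln (g x / m) + - k * g x))))%R.
    rewrite RintegralZ_ball// RintegralD_ball// RintegralZ_ball// RintegralD_ball//.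
    rewrite RintegralZ_ball// -/m -/E mulNr km subrr mulr0 addr0.
    rewrite /A powRD; last by rewrite (gt_eqF m0) implybT.
    by rewrite powRr1 ?(ltW m0)// -mulrA mulrC.
  apply: le_Rintegral_ball => //.
    by apply: loc_boundedM => //; exact: loc_bounded_cst.
  by move=> x _; rewrite mulNr; exact: powR_tangent_le.
have PL := @prekopa_leindler_ball _ d mu n t a b c A v0 mu_convex _ la lb lc _ _ _ abc _ _ Aa v0b.
have {}PL : A `^ (1 - t) * v0 `^ t <= (\int[mu]_(x in B n) c x)%R.
  apply: PL; rewrite ?t0 ?powR_ge0 ?expR_ge0 ?(ltW v00)//=; first lra.
  - by move=> x; exact: powR_ge0.
  - by move=> x; exact: expR_ge0.
  - move=> x; rewrite addr_ge0// mulr_ge0 ?expR_ge0 ?powR_ge0//.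
    by rewrite mulr_ge0 ?ltW.
  - by rewrite mulr_ge0 ?powR_ge0 ?expR_ge0.
(* The middle quantity equals [m * expR (t * (k + ln v0))]; take the tangent at 0. *)
have lower : m + t * E + t * m * ln v0 <= A `^ (1 - t) * v0 `^ t.
  rewrite /A powRM ?powR_ge0 ?expR_ge0// -powRrM sE powRr1 ?(ltW m0)//.
  rewrite -expRM [s * k * _]mulrAC sE' /powR (gt_eqF v00)/= -[leRHS]mulrA -expRD -mulrDr.
  have := ler_wpM2l (ltW m0) (@expR_ge1Dx R (t * (k + ln v0))).
  by apply: le_trans; rewrite -km; lra.
have upper : (\int[mu]_(x in B n) c x <= m + 2 * t * delta * (m + Y) + C * t * I)%R.
  have lZg : loc_bounded (fun x => `|x| `^ alpha * g x) by exact: loc_boundedM.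
  have lgZg : loc_bounded (fun x => g x + `|x| `^ alpha * g x) by exact: loc_boundedD.
  have l1 : loc_bounded (fun x => 2 * t * delta * (g x + `|x| `^ alpha * g x)).
    by apply: loc_boundedM => //; exact: loc_bounded_cst.
  have l2 : loc_bounded (fun x => C * t * (G x + eta) `^ beta).
    by apply: loc_boundedM => //; exact: loc_bounded_cst.
  have l3 : loc_bounded (fun x => 2 * t * delta * (g x + `|x| `^ alpha * g x) +
      C * t * (G x + eta) `^ beta) by exact: loc_boundedD.
  have -> : m + 2 * t * delta * (m + Y) + C * t * I =
      (\int[mu]_(x in B n) (g x + (2 * t * delta * (g x + `|x| `^ alpha * g x) +
        C * t * (G x + eta) `^ beta)))%R.
    rewrite RintegralD_ball// RintegralD_ball// RintegralZ_ball// RintegralZ_ball//.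
    by rewrite RintegralD_ball// addrA.
  apply: le_Rintegral_ball => //; first exact: loc_boundedD.
  move=> x xn; rewrite /c addrA lerD2r.
  have -> : g x + 2 * t * delta * (g x + `|x| `^ alpha * g x) =
      (1 + 2 * (t * (delta * (1 + `|x| `^ alpha)))) * g x by ring.
  rewrite ler_wpM2r//; apply: expR_le1D2; apply/andP; split.
    by rewrite !mulr_ge0 ?addr_ge0 ?powR_ge0// ltW.
  apply: (@le_trans _ _ (t * (delta * (1 + n `^ alpha)))); last by move: T3; lra.
  rewrite ler_pM2l// ler_pM2l// lerD2l; apply: ge0_ler_powR => //; rewrite ?nnegrE// ltW//.
have := le_trans lower (le_trans PL upper) => h.
rewrite -(ler_pM2l t0); move: h; lra.
Qed.

End defective_log_sobolev.

Section defective_log_sobolev_constants.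
Context {R : realType} (d : nat) (mu : probability 'rV[R]_d R).
Variables alpha beta eps : R.
Hypotheses (mu_convex : convex_measure mu) (alpha_gt1 : 1 < alpha)
  (betaE : beta = alpha / (alpha - 1)) (eps_gt0 : 0 < eps).
Hypothesis exp_moment :
  (\int[mu]_x (expR (eps * `|x| `^ alpha))%:E < +oo)%E.
Local Notation B := (@rV_ball R d).

Let beta1 : 1 < beta. Proof. exact: conjugate_gt1 alpha_gt1 betaE. Qed.

Let beta0 : 0 < beta. Proof. exact: lt_trans beta1. Qed.

Let alpha0 : 0 < alpha. Proof. exact: lt_trans alpha_gt1. Qed.

Lemma rV_ball_mass : exists2 N : nat, (0 < N)%N & (0 < mu (B N%:R))%E.
Proof.
apply: contrapT => /forall2NP H.
have B0 k : mu (B k.+1%:R) = 0%E.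
  have [//|/negP] := H k.+1; rewrite -leNgt => le0.
  by apply/eqP; rewrite eq_le le0/=.
have : (mu (\bigcup_k B k.+1%:R) <= 0)%E.
  have mBk k : measurable (B k.+1%:R) by exact: measurable_rV_ball.
  apply: (@le_trans _ _ (\sum_(0 <= k <oo) mu (B k.+1%:R))%E).
    by apply: measure_sigma_subadditive => //; exact: bigcup_measurable.
  by rewrite eseries0// => k _ _; rewrite B0.
have -> : \bigcup_k B k.+1%:R = setT.
  rewrite -subTset => x _; exists (Num.trunc `|x|) => //.
  by rewrite /rV_ball/= ltW// truncnS_gt.
by rewrite probability_setT leNgt lte01.
Qed.

(** The point is that [C1] and [C2] do not depend on the radius [n]. *)
Theorem defective_log_sobolev_ball : exists C1 C2 : R, exists N : nat,
  [/\ 0 < C1, 0 < C2 & forall n : nat, (N <= n)%N -> forall F G,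
    loc_bounded F -> loc_bounded G ->
    (forall x, 0 <= F x) -> (forall x, 0 <= G x) ->
    local_upper_gradient F G ->
    let m := (\int[mu]_(x in B n%:R) (F x `^ beta))%R in 0 < m ->
    (\int[mu]_(x in B n%:R) (F x `^ beta * ln (F x `^ beta / m)) <=
     C1 * \int[mu]_(x in B n%:R) (G x `^ beta) + C2 * m)%R].
Proof.
have [N N0 muN] := rV_ball_mass.
pose delta := eps / 4.
have delta0 : 0 < delta by rewrite divr_gt0.
have mB K : measurable (B K) := @measurable_rV_ball R d K.
have mu1 K : (mu (B K) <= 1)%E := probability_le1 mu (mB K).
have muBfin K : mu (B K) \is a fin_num := fin_num_measure mu _ (mB K).
pose b (x : 'rV[R]_d) := expR (- (delta * `|x| `^ alpha)).
have lZ : loc_bounded (fun x : 'rV[R]_d => `|x| `^ alpha).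
  by apply: loc_bounded_norm_powR; exact: ltW.
have lb : loc_bounded b.
  apply/loc_bounded_expR/loc_boundedN/loc_boundedM => //; exact: loc_bounded_cst.
(* Computed on the fixed ball of radius [N], which has positive mass, and hence valid for every
   larger ball. *)
pose v0 := expR (- (delta * N%:R `^ alpha)) * fine (mu (B N%:R)).
have v00 : 0 < v0.
  by rewrite mulr_gt0 ?expR_gt0// fine_gt0// muN/= (le_lt_trans (mu1 _))// ltry.
have v0b n : (N <= n)%N -> v0 <= (\int[mu]_(x in B n%:R) b x)%R.
  move=> Nn; rewrite -lee_fin EFin_Rintegral_ball//.
  apply: (@le_trans _ _ (\int[mu]_(x in B N%:R) (b x)%:E)%E).
    have -> : v0%:E = (\int[mu]_(x in B N%:R) (expR (- (delta * N%:R `^ alpha)))%:E)%E.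
      by rewrite integral_cst//= EFinM fineK.
    apply: ge0_le_integral => //.
      by apply/measurable_EFinP/measurable_funTS; exact: (proj1 lb).
    move=> x xN; rewrite lee_fin ler_expR lerN2 ler_pM2l//.
    by apply: ge0_ler_powR => //; rewrite ?nnegrE ?ler0n// ltW.
  apply: ge0_subset_integral => //.
  - by apply/measurable_EFinP/measurable_funTS; exact: (proj1 lb).
  - by move=> x _; rewrite lee_fin expR_ge0.
  by move=> x; rewrite /rV_ball/= => /le_trans; apply; rewrite ler_nat.
have lexp : loc_bounded (fun x : 'rV[R]_d => expR (eps * `|x| `^ alpha)).
  apply/loc_bounded_expR/loc_boundedM => //; exact: loc_bounded_cst.
pose K := fine (\int[mu]_x (expR (eps * `|x| `^ alpha))%:E)%E.
have K0 : 0 <= K.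
  by rewrite fine_ge0// integral_ge0// => x _; rewrite lee_fin expR_ge0.
have expK n : (\int[mu]_(x in B n) (expR (eps * `|x| `^ alpha)) <= K)%R.
  rewrite -lee_fin EFin_Rintegral_ball// fineK; last first.
    rewrite ge0_fin_numE// integral_ge0// => x _; rewrite lee_fin; exact: expR_ge0.
  by apply: ge0_subset_integral => //; apply/measurable_EFinP; exact: (proj1 lexp).
have [C CE] : exists C, C = gradient_cst alpha beta delta by eexists.
have C0 : 0 < C by rewrite CE; exact: gradient_cst_gt0.
pose c2 : R := 2 `^ (beta - 1).
have c20 : 0 < c2 by rewrite powR_gt0.
(* The factors 2 come from absorbing half of the entropy into the left-hand side. *)
exists (2 * C * c2), (2 * `|ln v0| + eps + K + 2 * C * c2), N; split.
- by rewrite !mulr_gt0.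
- by rewrite ltr_wpDl ?mulr_gt0// addr_ge0// addr_ge0 ?mulr_ge0// ltW.
move=> n Nn F G lF lG F0 G0 FG m m0.
pose eta := m `^ beta^-1.
have eta0 : 0 < eta by rewrite powR_gt0.
have n0 : 0 < n%:R :> R by rewrite ltr0n (leq_trans N0).
have := @entropy_ball_le _ d mu alpha beta mu_convex alpha_gt1 betaE delta n%:R v0 eta F G
  delta0 n0 v00 eta0 (v0b _ Nn) lF lG F0 G0 FG m0.
rewrite -/m -CE.
set E := Rintegral _ _ _; set Y := Rintegral _ _ _; set I := Rintegral _ _ _.
set J := Rintegral _ _ _ => main.
pose g x := F x `^ beta.
have g0 x : 0 <= g x by exact: powR_ge0.
have lg : loc_bounded g by apply: loc_bounded_powR => //; exact: ltW.
have lGb : loc_bounded (fun x => G x `^ beta) by apply: loc_bounded_powR => //; exact: ltW.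
have lent : loc_bounded (fun x => g x * ln (g x / m)) by exact: loc_bounded_entropy.
have leY : eps * Y <= E + m * K.
  apply: (@le_trans _ _ (\int[mu]_(x in B n%:R)
      (g x * ln (g x / m) + m * expR (eps * `|x| `^ alpha)))%R).
    rewrite /Y -RintegralZ_ball; last exact: loc_boundedM.
    apply: le_Rintegral_ball.
    - by apply: loc_boundedM; [exact: loc_bounded_cst|exact: loc_boundedM].
    - by apply: loc_boundedD => //; apply: loc_boundedM => //; exact: loc_bounded_cst.
    move=> x _; have := mul_le_entropy_expR (eps * `|x| `^ alpha) (g0 x) m0.
    have := g0 x; rewrite /g; lra.
  rewrite RintegralD_ball//; last by apply: loc_boundedM => //; exact: loc_bounded_cst.
  by rewrite RintegralZ_ball// lerD2l ler_pM2l.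
have leI : I <= c2 * (J + m).
  apply: (@le_trans _ _ (\int[mu]_(x in B n%:R) (c2 * (G x `^ beta + m)))%R).
    apply: le_Rintegral_ball.
    - apply: loc_bounded_powR; [exact: ltW|by move=> x; rewrite addr_ge0// ltW|].
      by apply: loc_boundedD => //; exact: loc_bounded_cst.
    - apply: loc_boundedM; first exact: loc_bounded_cst.
      by apply: loc_boundedD => //; exact: loc_bounded_cst.
    move=> x _; have := powR_add_le2 (G0 x) (ltW eta0) (ltW beta1).
    by rewrite {2}/eta -powRrM mulVf ?gt_eqF// powRr1// ltW.
  rewrite RintegralZ_ball; last by apply: loc_boundedD => //; exact: loc_bounded_cst.
  rewrite ler_pM2l// RintegralD_ball//; last exact: loc_bounded_cst.
  rewrite lerD2l Rintegral_cst// -[leRHS]mulr1 ler_pM2l//.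
  by rewrite -lee_fin fineK ?muBfin ?mu1.
have leln : - ln v0 <= `|ln v0| by rewrite -normrN ler_norm.
have H1 : m * - ln v0 <= m * `|ln v0| by rewrite ler_pM2l.
have H2 : C * I <= C * (c2 * (J + m)) by rewrite ler_pM2l.
move: main; rewrite /delta; lra.
Qed.

End defective_log_sobolev_constants.

(** * Tightening *)

Section tightening_inequalities.
Context {R : realType}.
Implicit Types u h beta : R.

Lemma ln_leB1 u : 0 < u -> ln u <= u - 1.
Proof.
move=> u0; have -> : ln u = ln (1 + (u - 1)) by rewrite addrC subrK.
by apply: le_ln1Dx; lra.
Qed.

Definition xlnx (g : R) := g * ln g.

(** [xlnx] minus its tangent at 1: nonnegative, quadratic near 1, and with the same integral as
    [xlnx] when the mean of [g] is 1. *)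
Definition relent (g : R) := xlnx g - g + 1.

Lemma xlnx_ge g : 0 <= g -> g - 1 <= xlnx g.
Proof. by move=> g0; have := entropy_integrand_ge g0 ltr01; rewrite divr1. Qed.

Lemma relent_ge0 g : 0 <= g -> 0 <= relent g.
Proof. by move=> /xlnx_ge; rewrite /relent; lra. Qed.

(** Inserting [ln u <= u - 1] leaves [2 u^3 - 3 u^2 + 1], which factors as on the right. *)
Lemma relent_sqr_le u : 0 <= u -> relent (u ^+ 2) <= (u - 1) ^+ 2 * (2 * u + 1).
Proof.
rewrite le_eqVlt => /predU1P[<-|u0]; first by rewrite /relent /xlnx; lra.
rewrite /relent /xlnx lnXn// -mulr_natl.
have := ler_wpM2l (sqr_ge0 u) (ln_leB1 u0); rewrite !expr2; nra.
Qed.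

Section pointwise.
Variable beta : R.
Hypothesis beta1 : 1 < beta.

Let beta0 : 0 < beta. Proof. exact: lt_trans beta1. Qed.

Let w : R := 2 `^ (beta / 2).

Let w1 : 1 < w.
Proof.
have := @gt0_ltr_powR R (beta / 2) _ 1 2; rewrite powR1; apply; rewrite ?nnegrE//.
- by rewrite divr_gt0.
- by rewrite ltr1n.
Qed.

Definition trunc_excess h : R := Num.max (h - 2) 0.

Lemma trunc_excess_ge0 h : 0 <= trunc_excess h.
Proof. by rewrite le_max lexx orbT. Qed.

Definition excess_cst : R := (w / (w - 1)) ^+ 2.

Lemma excess_cst_gt0 : 0 < excess_cst.
Proof. by rewrite exprn_gt0// divr_gt0 ?subr_gt0// (lt_trans _ w1). Qed.

Let sqr_half h : 0 <= h -> (h `^ (beta / 2)) ^+ 2 = h `^ beta.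
Proof.
by move=> h0; rewrite -powR_mulrn ?powR_ge0// -powRrM divfK.
Qed.

Lemma trunc_excess_powR_le h : 0 <= h ->
  trunc_excess h `^ beta <= excess_cst * (h `^ (beta / 2) - 1) ^+ 2.
Proof.
move=> h0; have [h2|h2] := leP h 2.
  rewrite /trunc_excess max_r ?subr_le0// powR0 ?gt_eqF//.
  by rewrite mulr_ge0 ?sqr_ge0// ltW ?excess_cst_gt0.
have wh : w <= h `^ (beta / 2).
  by apply: ge0_ler_powR; rewrite ?nnegrE ?divr_ge0// ltW.
apply: (@le_trans _ _ (h `^ beta)).
  apply: ge0_ler_powR; rewrite ?nnegrE ?trunc_excess_ge0// ?ltW//.
  by rewrite gt_max; apply/andP; split; lra.
rewrite -sqr_half// /excess_cst -exprMn ler_sqr ?nnegrE ?powR_ge0//; last first.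
  rewrite mulr_ge0// ?divr_ge0 ?subr_ge0 ?(ltW w1)//; last by rewrite (le_trans _ wh)// ltW.
  by rewrite (le_trans _ (ltW w1)).
by rewrite mulrAC ler_pdivlMr ?subr_gt0//; move: w1 wh; nra.
Qed.

Definition relent_cst : R := 2 * 2 `^ beta + 1 + 2 * 2 `^ beta / (w - 1) ^+ 2.

Lemma relent_cst_gt0 : 0 < relent_cst.
Proof.
have A0 : 0 < 2 * 2 `^ beta :> R by rewrite mulr_gt0 ?powR_gt0.
have B0 : 0 < (w - 1) ^+ 2 by rewrite exprn_gt0 ?subr_gt0.
by apply: addr_gt0; [exact: addr_gt0|exact: divr_gt0].
Qed.

Lemma relent_powR_le h : 0 <= h ->
  relent (h `^ beta) <= relent_cst * (h `^ (beta / 2) - 1) ^+ 2 +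
    2 * 2 `^ beta * xlnx (trunc_excess h `^ beta).
Proof.
move=> h0; set u := h `^ (beta / 2).
have u0 : 0 <= u by exact: powR_ge0.
have b20 : 0 < 2 `^ beta :> R by rewrite powR_gt0.
have D0 : 0 <= (u - 1) ^+ 2 := sqr_ge0 _.
have w10 : 0 < (w - 1) ^+ 2 by rewrite exprn_gt0 ?subr_gt0.
have [h4|h4] := leP h 4.
  have uA : u <= 2 `^ beta.
    have -> : 2 `^ beta = 4 `^ (beta / 2) :> R.
      have -> : 4 = 2 ^+ 2 :> R by rewrite expr2; lra.
      by rewrite -powR_mulrn// -powRrM mulrCA divff ?mulr1.
    by apply: ge0_ler_powR; rewrite ?nnegrE ?divr_ge0// ltW.
  have H1 : relent (h `^ beta) <= (u - 1) ^+ 2 * (2 * 2 `^ beta + 1).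
    rewrite -sqr_half//; apply: (le_trans (relent_sqr_le u0)).
    by rewrite ler_wpM2l//; lra.
  have H2 : - ((u - 1) ^+ 2 / (w - 1) ^+ 2) <= xlnx (trunc_excess h `^ beta).
    have [h2|h2] := leP h 2.
      rewrite /trunc_excess max_r ?subr_le0// powR0 ?gt_eqF// /xlnx mul0r.
      by rewrite oppr_le0 divr_ge0// ltW.
    apply: le_trans (xlnx_ge (powR_ge0 _ _)).
    apply: (@le_trans _ _ (-1)); last by have := powR_ge0 (trunc_excess h) beta; lra.
    rewrite lerN2 ler_pdivlMr// mul1r ler_sqr ?nnegrE ?subr_ge0.
    - rewrite lerD2r; apply: ge0_ler_powR; rewrite ?nnegrE ?divr_ge0// ltW//.
    - exact: ltW.
    apply: (@le_trans _ _ w); first exact: ltW.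
    by apply: ge0_ler_powR; rewrite ?nnegrE ?divr_ge0// ltW.
  have := ler_wpM2l (ltW b20) H2; rewrite /relent_cst.
  by move: H1; rewrite -!mulrA; lra.
(* Beyond 4 both [h <= 2 * (h - 2)] and [h <= (h - 2) ^+ 2] hold: the first compares the powers, the
   second the logarithms. *)
have h00 : 0 < h by lra.
have F2 : h / 2 <= h - 2 by lra.
have FE : trunc_excess h = h - 2 by rewrite /trunc_excess max_l//; lra.
have hb1 : 1 <= h `^ beta.
  have := @ge0_ler_powR R beta (ltW beta0) 1 h; rewrite powR1; apply; rewrite ?nnegrE//; lra.
have H1 : h `^ beta <= 2 `^ beta * (h - 2) `^ beta.
  by rewrite -powRM ?subr_ge0//; [apply: ge0_ler_powR; rewrite ?nnegrE ?(ltW beta0)//; lra|lra].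
have H2 : ln (h `^ beta) <= 2 * ln ((h - 2) `^ beta).
  rewrite !ln_powR mulrCA ler_pM2l//.
  have -> : 2 * ln (h - 2) = ln ((h - 2) ^+ 2) by rewrite lnXn ?mulr_natl//; lra.
  by rewrite ler_ln ?posrE ?exprn_gt0//; [nra|lra].
have ln0 : 0 <= ln (h `^ beta) by rewrite ln_ge0.
have H3 : xlnx (h `^ beta) <= 2 * 2 `^ beta * xlnx (trunc_excess h `^ beta).
  rewrite FE /xlnx.
  apply: (@le_trans _ _ (2 `^ beta * (h - 2) `^ beta * (2 * ln ((h - 2) `^ beta)))).
    by apply: ler_pM => //; exact: powR_ge0.
  by rewrite le_eqVlt; apply/orP; left; apply/eqP; ring.
have H4 : 0 <= relent_cst * (u - 1) ^+ 2 by rewrite mulr_ge0// ltW// relent_cst_gt0.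
rewrite /relent; lra.
Qed.

End pointwise.
End tightening_inequalities.

Section tight_log_sobolev.
Context {R : realType} (d : nat) (mu : probability 'rV[R]_d R).
Variables alpha beta eps : R.
Hypotheses (mu_convex : convex_measure mu) (alpha_gt1 : 1 < alpha)
  (betaE : beta = alpha / (alpha - 1)) (eps_gt0 : 0 < eps).
Hypothesis exp_moment :
  (\int[mu]_x (expR (eps * `|x| `^ alpha))%:E < +oo)%E.
Local Notation B := (@rV_ball R d).

Let beta1 : 1 < beta. Proof. exact: conjugate_gt1 alpha_gt1 betaE. Qed.

Let beta0 : 0 < beta. Proof. exact: lt_trans beta1. Qed.

Lemma loc_bounded_xlnx (g : 'rV[R]_d -> R) : (forall x, 0 <= g x) ->
  loc_bounded g -> loc_bounded (fun x => xlnx (g x)).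
Proof.
move=> g0 lg; have := loc_bounded_entropy ltr01 g0 lg.
by under eq_fun do rewrite divr1.
Qed.

(** For [0 < m <= 1], dividing by [m] only increases the logarithm. For [m = 0] the entropy bound
    says nothing, but [xlnx g] is at most a constant times [g], whose integral vanishes. *)
Lemma Rintegral_ball_xlnx_le (g : 'rV[R]_d -> R) (K m C : R) :
  (forall x, 0 <= g x) -> loc_bounded g -> 0 <= C ->
  m = (\int[mu]_(x in B K) g x)%R -> m <= 1 ->
  (0 < m -> (\int[mu]_(x in B K) (g x * ln (g x / m)) <= C)%R) ->
  (\int[mu]_(x in B K) xlnx (g x) <= C)%R.
Proof.
move=> g0 lg C0 mE m1 H.
have lx := loc_bounded_xlnx g0 lg.
have : 0 <= m by rewrite mE Rintegral_ge0.
rewrite le_eqVlt => /predU1P[m0|m0]; last first.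
  apply: le_trans (H m0).
  have lent := loc_bounded_entropy m0 g0 lg.
  apply: le_Rintegral_ball => // x _; rewrite /xlnx.
  have [->|gx0] := eqVneq (g x) 0; first by rewrite !mul0r.
  have gx : 0 < g x by rewrite lt_def gx0 g0.
  rewrite ler_pM2l// ler_ln ?posrE ?divr_gt0// ler_pdivlMr//.
  by rewrite ler_piMr.
have [_ /(_ K)[M gM]] := lg.
apply: (@le_trans _ _ (\int[mu]_(x in B K) (M * g x))%R).
  apply: le_Rintegral_ball => //.
    by apply: loc_boundedM => //; exact: loc_bounded_cst.
  move=> x /gM; rewrite ger0_norm// => gxM; rewrite /xlnx mulrC.
  have := g0 x; rewrite le_eqVlt => /predU1P[<-|gx0]; first by rewrite !mulr0.
  by rewrite ler_pM2r// (le_trans _ gxM)// ltW// ln_sublinear.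
by rewrite RintegralZ_ball// -mE -m0 mulr0.
Qed.

(** Integrating [relent] rather than [xlnx] keeps the left-hand side nonnegative, so the bounds on
    balls pass to the whole space by monotone convergence even if some integrals are infinite. *)
Theorem relent_log_sobolev : exists2 C : R, 0 < C &
  forall h G : 'rV[R]_d -> R, loc_bounded h -> loc_bounded G ->
    (forall x, 0 <= h x) -> (forall x, 0 <= G x) ->
    local_upper_gradient (fun x => trunc_excess (h x)) G ->
    (\int[mu]_x (h x `^ beta)%:E <= 1)%E ->
    (\int[mu]_x (relent (h x `^ beta))%:E <=
     C%:E * (\int[mu]_x (G x `^ beta)%:E +
             \int[mu]_x ((h x `^ (beta / 2) - 1) ^+ 2)%:E))%E.
Proof.
have [C1 [C2 [N [C10 C20 defective]]]] :=
  defective_log_sobolev_ball mu_convex alpha_gt1 betaE eps_gt0 exp_moment.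
pose K1 := relent_cst beta; pose K2 : R := 2 * 2 `^ beta; pose K3 := excess_cst beta.
have K10 : 0 < K1 := relent_cst_gt0 beta1.
have K20 : 0 < K2 by rewrite mulr_gt0 ?powR_gt0.
have K30 : 0 < K3 := excess_cst_gt0 beta1.
pose C := K1 + K2 * C1 + K2 * C2 * K3.
have C0 : 0 < C.
  apply: addr_gt0; first by apply: addr_gt0 => //; exact: mulr_gt0.
  by apply: mulr_gt0 => //; exact: mulr_gt0.
exists C => // h G lh lG h0 G0 hG h1.
have mB K : measurable (B K) := @measurable_rV_ball R d K.
pose F x := trunc_excess (h x).
have F0 x : 0 <= F x := trunc_excess_ge0 (h x).
have lF : loc_bounded F.
  have [mh bh] := lh; split; first by apply: measurable_maxr => //; exact: measurable_funB.
  move=> K; have [M hM] := bh K; exists M => x xK.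
  rewrite ger0_norm// /F /trunc_excess ge_max; have := hM x xK; have := h0 x.
  by rewrite ger0_norm//= => ? ?; apply/andP; split; lra.
pose g x := F x `^ beta.
have g0 x : 0 <= g x by exact: powR_ge0.
have lg : loc_bounded g by apply: loc_bounded_powR => //; exact: ltW.
pose D x := (h x `^ (beta / 2) - 1) ^+ 2.
have D0 x : 0 <= D x by exact: sqr_ge0.
have lD : loc_bounded D.
  have l1 : loc_bounded (fun x => h x `^ (beta / 2) - 1).
    apply: loc_boundedD; last exact: loc_bounded_cst.
    by apply: loc_bounded_powR => //; rewrite divr_ge0// ltW.
  exact: loc_boundedM.
have lGb : loc_bounded (fun x => G x `^ beta) by apply: loc_bounded_powR => //; exact: ltW.
have lhb : loc_bounded (fun x => h x `^ beta) by apply: loc_bounded_powR => //; exact: ltW.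
pose P x := relent (h x `^ beta).
have P0 x : 0 <= P x by exact/relent_ge0/powR_ge0.
have lP : loc_bounded P.
  apply: loc_boundedD; last exact: loc_bounded_cst.
  apply: loc_boundedD; last exact: loc_boundedN.
  by apply: loc_bounded_xlnx => // x; exact: powR_ge0.
have lx : loc_bounded (fun x => xlnx (g x)) by exact: loc_bounded_xlnx.
have lZ (c : R) f : loc_bounded f -> loc_bounded (fun x : 'rV[R]_d => c * f x).
  by move=> lf; apply: loc_boundedM => //; exact: loc_bounded_cst.
have ball n : (N <= n)%N -> (\int[mu]_(x in B n%:R) P x <=
    C * (\int[mu]_(x in B n%:R) (G x `^ beta) + \int[mu]_(x in B n%:R) D x))%R.
  move=> Nn; set J := (\int[mu]_(x in B n%:R) (G x `^ beta))%R.
  set I := (\int[mu]_(x in B n%:R) D x)%R.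
  have J0 : 0 <= J by apply: Rintegral_ge0 => x _; exact: powR_ge0.
  have I0 : 0 <= I by apply: Rintegral_ge0.
  pose m := (\int[mu]_(x in B n%:R) g x)%R.
  have m0 : 0 <= m by apply: Rintegral_ge0.
  have mI : m <= K3 * I.
    rewrite -RintegralZ_ball//; apply: le_Rintegral_ball => //; first exact: lZ.
    by move=> x _; exact: trunc_excess_powR_le.
  have m1 : m <= 1.
    rewrite -lee_fin EFin_Rintegral_ball//; apply: le_trans h1.
    apply: (@le_trans _ _ (\int[mu]_(x in B n%:R) (h x `^ beta)%:E)%E).
      apply: ge0_le_integral => //.
      - by move=> x _; rewrite lee_fin.
      - by apply/measurable_EFinP/measurable_funTS; exact: (proj1 lg).
      - by apply/measurable_EFinP/measurable_funTS; exact: (proj1 lhb).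
      move=> x _; rewrite lee_fin; apply: ge0_ler_powR; rewrite ?nnegrE ?(ltW beta0)//.
      by rewrite /F /trunc_excess ge_max h0 andbT; lra.
    apply: ge0_subset_integral => //; first by apply/measurable_EFinP; exact: (proj1 lhb).
    by move=> x _; rewrite lee_fin powR_ge0.
  have xle : (\int[mu]_(x in B n%:R) xlnx (g x) <= C1 * J + C2 * m)%R.
    apply: (@Rintegral_ball_xlnx_le _ _ m) => //.
      by rewrite addr_ge0// mulr_ge0// ltW.
    by move=> mpos; exact: defective.
  have P1 : (\int[mu]_(x in B n%:R) P x <= K1 * I + K2 * \int[mu]_(x in B n%:R) xlnx (g x))%R.
    rewrite -RintegralZ_ball// -RintegralZ_ball// -RintegralD_ball//; [|exact: lZ..].
    apply: le_Rintegral_ball => //; first by apply: loc_boundedD; exact: lZ.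
    by move=> x _; exact: relent_powR_le.
  apply: (le_trans P1).
  have H1 : K2 * \int[mu]_(x in B n%:R) xlnx (g x) <= K2 * (C1 * J + C2 * m)%R by rewrite ler_pM2l.
  have H2 : K2 * C2 * m <= K2 * C2 * (K3 * I) by rewrite ler_pM2l//; exact: mulr_gt0.
  (* One constant [C] multiplies both integrals; these are the nonnegative surplus terms that this
     adds. *)
  have H3 : 0 <= K1 * J + K2 * C2 * K3 * J + K2 * C1 * I.
    have a1 : 0 <= K1 * J by apply: mulr_ge0 => //; exact: ltW.
    have a2 : 0 <= K2 * C2 * K3 * J.
      by apply: mulr_ge0 => //; apply/ltW/mulr_gt0 => //; exact: mulr_gt0.
    have a3 : 0 <= K2 * C1 * I by apply: mulr_ge0 => //; apply/ltW/mulr_gt0.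
    by rewrite !addr_ge0.
  rewrite /C; move: H1 H2 H3; lra.
have mP : measurable_fun [set: 'rV[R]_d] P := proj1 lP.
(* The radii start at [N], from which on the ball inequality is available. *)
apply: (@nondecreasing_integral_le _ _ _ _ (fun k x => (P x * \1_(B (N + k)%:R) x)%:E)).
- by move=> k; apply/measurable_EFinP; exact: measurable_funM.
- by move=> k x; rewrite lee_fin mulr_ge0.
- move=> x i j ij; rewrite lee_fin ler_wpM2l// !indicE ler_nat.
  case: (boolP (x \in B _)) => // /set_mem xi; rewrite mem_set//.
  by rewrite /rV_ball/= (le_trans xi)// ler_nat leq_add2l.
- move=> x; apply: cvg_near_cst; exists (Num.trunc `|x|).+1 => // k /= xk.
  rewrite indicE mem_set ?mulr1// /rV_ball/= (le_trans (ltW (truncnS_gt _)))//.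
  by rewrite ler_nat (leq_trans xk)// leq_addl.
move=> k; set n := (N + k)%N.
have subB f : (forall x, 0 <= f x) -> loc_bounded f ->
    ((\int[mu]_(x in B n%:R) f x)%R%:E <= \int[mu]_x (f x)%:E)%E.
  move=> f0 lf; rewrite EFin_Rintegral_ball//.
  apply: ge0_subset_integral => //; first by apply/measurable_EFinP; exact: (proj1 lf).
  by move=> x _; rewrite lee_fin.
have -> : (\int[mu]_x (P x * \1_(B n%:R) x)%:E)%E = (\int[mu]_(x in B n%:R) P x)%R%:E.
  rewrite EFin_Rintegral_ball// [RHS]integral_mkcond; apply: eq_integral => x _.
  by rewrite patchE indicE; case: ifP; rewrite ?mulr1 ?mulr0.
apply: (@le_trans _ _ (C * (\int[mu]_(x in B n%:R) (G x `^ beta) +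
    \int[mu]_(x in B n%:R) D x))%R%:E).
  by rewrite lee_fin ball// leq_addr.
rewrite EFinM; apply: lee_wpmul2l; first by rewrite lee_fin ltW.
by rewrite EFinD; apply: leeD; apply: subB => // x; exact: powR_ge0.
Qed.

End tight_log_sobolev.

(** * From smooth functions to the relative entropy inequality *)

Section reduction.
Context {R : realType} (d : nat).

Lemma norm_le_eucl_norm (x : 'rV[R]_d) : `|x| <= eucl_norm x.
Proof.
apply: rV_norm_le => [|i]; first exact: sqrtr_ge0.
rewrite /eucl_norm -[leLHS]sqrtr_sqr ler_wsqrtr// (bigD1 i)//= lerDl.
by apply: sumr_ge0 => j _; exact: sqr_ge0.
Qed.

Lemma loc_bounded_eucl_norm (v : 'I_d -> 'rV[R]_d -> R) :
  (forall i, loc_bounded (v i)) -> loc_bounded (fun x => eucl_norm (\row_i v i x)).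
Proof.
move=> lv.
have -> : (fun x => eucl_norm (\row_i v i x)) =
    (fun x => (\sum_(i < d) v i x ^+ 2) `^ 2^-1).
  apply/funext => x; rewrite /eucl_norm powR12_sqrt; last first.
    by apply: sumr_ge0 => i _; exact: sqr_ge0.
  by congr Num.sqrt; apply: eq_bigr => i _; rewrite mxE.
apply: loc_bounded_powR => //.
  by move=> x; apply: sumr_ge0 => i _; exact: sqr_ge0.
have -> : (fun x => \sum_(i < d) v i x ^+ 2) = \sum_(i < d) (fun x => v i x ^+ 2).
  by apply/funext => x; rewrite fct_sumE.
apply: (big_ind (@loc_bounded R d)) => [|f g lf lg|i _].
- exact: (@loc_bounded_cst R d 0).
- exact: loc_boundedD.
exact: loc_boundedM.
Qed.

(** Absolute value and truncation are 1-Lipschitz, so only the factor [c] appears; the slack passed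
    to the Lipschitz estimate is [eta / c] to compensate for it. *)
Lemma trunc_excess_local_upper_gradient (f : 'rV[R]_d -> R) (c : R) : smooth f ->
  0 < c ->
  local_upper_gradient (fun x => trunc_excess (c * `|f x|))
    (fun x => c * d%:R * eucl_norm (gradient f x)).
Proof.
move=> sf c0 K eta eta0.
have [|r r0 rP] := @Ck1_local_lipschitz R d f K (eta / c) (sf 1%N); first by rewrite divr_gt0.
exists r => // z x zK xz; have := ler_wpM2l (ltW c0) (rP z x zK xz).
have -> : c * (`|x - z| * (d%:R * eucl_norm (gradient f z) + eta / c)) =
    `|x - z| * (c * d%:R * eucl_norm (gradient f z) + eta) by field; rewrite gt_eqF.
have : c * (`|f x| - `|f z|) <= c * `|f x - f z| by rewrite ler_pM2l// lerB_dist.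
rewrite mulrBr; set N := _ * (_ + eta); set a := c * `|f x|; set b := c * `|f z|.
set e := c * `|_ - _| => h1 h2.
have N0 : 0 <= N by apply: le_trans h2; apply: mulr_ge0 => //; exact: ltW.
rewrite /trunc_excess ge_max; apply/andP; split; last first.
  by rewrite addr_ge0// le_max lexx orbT.
have : b - 2 <= Num.max (b - 2) 0 by rewrite le_max lexx.
lra.
Qed.

End reduction.

Section integral_reduction.
Context disp (T : measurableType disp) (R : realType) (mu : probability T R).
Local Open Scope ereal_scope.

(** An inequality suffices, and it covers the case where [P] is not integrable, so that the entropy
    need not be known to be finite. *)
Lemma integralD_zero_mean_le (P Q : T -> R) : measurable_fun [set: T] P ->
  (forall x, (0 <= P x)%R) -> mu.-integrable [set: T] (EFin \o Q) ->
  \int[mu]_x (Q x)%:E = 0 ->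
  \int[mu]_x (P x + Q x)%:E <= \int[mu]_x (P x)%:E.
Proof.
move=> mP P0 iQ Q0; have [->|Pfin] := eqVneq (\int[mu]_x (P x)%:E) +oo.
  exact: leey.
have iP : mu.-integrable [set: T] (EFin \o P).
  apply/integrableP; split; first exact/measurable_EFinP.
  under eq_integral do rewrite /= ger0_norm//.
  by rewrite ltey.
by rewrite integralD_EFin// Q0 adde0.
Qed.

(** With [e] the mean of [X], the left side is [2 * s - 2 * Num.sqrt s * e] and the variance is
    [s - e ^+ 2]. Nonnegativity of the variance gives [e <= Num.sqrt s], whence
    [e ^+ 2 <= Num.sqrt s * e]. *)
Lemma integral_sqr_sub_le_variance (X : T -> R) (s : R) :
  measurable_fun [set: T] X -> (forall x, (0 <= X x)%R) ->
  \int[mu]_x (X x ^+ 2)%:E = s%:E ->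
  \int[mu]_x ((X x - Num.sqrt s) ^+ 2)%:E <= 2%:E * 'V_mu[X].
Proof.
move=> mX X0 Xs.
have iX2 : mu.-integrable [set: T] (EFin \o (fun x => X x ^+ 2)%R).
  apply/integrableP; split; first by apply/measurable_EFinP; exact: measurable_funX.
  under eq_integral do rewrite /= ger0_norm ?sqr_ge0//.
  by rewrite Xs ltry.
have ic (c : R) : mu.-integrable [set: T] (EFin \o (fun=> c)).
  exact: finite_measure_integrable_cst.
have iX : mu.-integrable [set: T] (EFin \o X).
  apply: (@le_integrable _ _ _ _ _ _ _ (EFin \o (fun x => 1 + X x ^+ 2)%R)) => //.
  - exact/measurable_EFinP.
  - move=> x _; rewrite /= lee_fin ger0_norm// ger0_norm ?addr_ge0 ?sqr_ge0//.
    by have := sqr_ge0 (X x - 1)%R; rewrite !expr2; have := X0 x; nra.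
  exact: (integrableD _ (ic 1%R) iX2).
pose e := fine 'E_mu[X].
have XE : \int[mu]_x (X x)%:E = e%:E.
  by rewrite /e unlock fineK//; exact: integrable_fin_num.
have E c : \int[mu]_x ((X x - c) ^+ 2)%:E = (s - 2 * c * e + c ^+ 2)%:E.
  have iZ : mu.-integrable [set: T] (EFin \o (fun x => - (2 * c) * X x)%R).
    by have := integrableZl measurableT (- (2 * c))%R iX.
  transitivity (\int[mu]_x ((X x ^+ 2 + - (2 * c) * X x) + c ^+ 2)%:E).
    by apply: eq_integral => x _; congr EFin; ring.
  rewrite integralD_EFin//; last exact: (integrableD _ iX2 iZ).
  rewrite integralD_EFin// Xs integral_cst//= probability_setT mule1.
  under eq_integral do rewrite EFinM.
  rewrite integralZl// XE -EFinM -!EFinD; congr EFin; ring.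
have VE : 'V_mu[X] = (s - e ^+ 2)%:E.
  rewrite /variance covariance.unlock -/e expectation.unlock.
  transitivity (\int[mu]_x ((X x - e) ^+ 2)%:E); first by apply: eq_integral => x _; rewrite expr2.
  by rewrite E; congr EFin; ring.
have e0 : (0 <= e)%R by rewrite -lee_fin -XE integral_ge0// => x _; rewrite lee_fin.
have se : (0 <= s - e ^+ 2)%R.
  by rewrite -lee_fin -VE; exact: variance_ge0.
have s0 : (0 <= s)%R by have := sqr_ge0 e; lra.
have es : (e <= Num.sqrt s)%R by rewrite -[leLHS]ger0_norm// -sqrtr_sqr ler_wsqrtr//; lra.
rewrite E VE -EFinM lee_fin sqr_sqrtr//.
by have := ler_wpM2r e0 es; rewrite expr2; lra.
Qed.

End integral_reduction.

Theorem theorem4p4 (R : realType) (d : nat) (mu : probability 'rV[R]_d R)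
    (alpha eps beta : R)
    (mu_convex : convex_measure mu)
    (alpha_gt1 : 1 < alpha) (eps_gt0 : 0 < eps)
    (exp_moment :
      (\int[mu]_x (expR (eps * (eucl_norm x `^ alpha)))%:E < +oo)%E)
    (betaE : beta = alpha / (alpha - 1)) :
  exists C : R, 0 < C /\
    forall f : 'rV[R]_d -> R, smooth f ->
      (0 < \int[mu]_x (`|f x| `^ beta)%:E)%E ->
      (\int[mu]_x (`|f x| `^ beta)%:E < +oo)%E ->
      (entropy mu (fun x => `|f x| `^ beta)%R
        <= C%:E * (\int[mu]_x (eucl_norm (gradient f x) `^ beta)%:E
                   + 'V_mu[(fun x => `|f x| `^ (beta / 2))%R]))%E.
Proof.
have beta1 : 1 < beta := conjugate_gt1 alpha_gt1 betaE.
have beta0 : 0 < beta by exact: lt_trans beta1.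
have alpha0 : 0 < alpha by exact: lt_trans alpha_gt1.
have leucl : loc_bounded (@eucl_norm R d).
  have -> : @eucl_norm R d = (fun x => eucl_norm (\row_i x ord0 i)).
    by apply/funext => x; congr eucl_norm; apply/rowP => i; rewrite mxE.
  apply: loc_bounded_eucl_norm => i; apply: loc_bounded_continuous.
  exact: coord_continuous.
have eucl0 (x : 'rV[R]_d) : 0 <= eucl_norm x by exact: sqrtr_ge0.
have exp_moment' : (\int[mu]_x (expR (eps * `|x| `^ alpha))%:E < +oo)%E.
  apply: le_lt_trans exp_moment; apply: ge0_le_integral => //.
  - apply/measurable_EFinP; suff [] :
      loc_bounded (fun x : 'rV[R]_d => expR (eps * `|x| `^ alpha)) by [].
    apply/loc_bounded_expR/loc_boundedM; first exact: loc_bounded_cst.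
    by apply: loc_bounded_norm_powR; exact: ltW.
  - apply/measurable_EFinP; suff [] :
      loc_bounded (fun x : 'rV[R]_d => expR (eps * eucl_norm x `^ alpha)) by [].
    apply/loc_bounded_expR/loc_boundedM; first exact: loc_bounded_cst.
    by apply: loc_bounded_powR => //; exact: ltW.
  move=> x _; rewrite lee_fin ler_expR ler_pM2l//.
  by apply: ge0_ler_powR; rewrite ?nnegrE ?(ltW alpha0)//; exact: norm_le_eucl_norm.
have [C C0 HC] := relent_log_sobolev mu_convex alpha_gt1 betaE eps_gt0 exp_moment'.
have k0 : 0 < d%:R `^ beta + 2 :> R by rewrite ltr_wpDl ?powR_ge0.
exists (C * (d%:R `^ beta + 2)); split; first exact: mulr_gt0.
move=> f sf f_gt0 f_fin.
have cf : continuous f by have [] := sf 0%N.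
have labs : loc_bounded (fun x => `|f x|).
  by apply: loc_bounded_continuous => x; apply: continuous_comp; [exact: cf|exact: norm_continuous].
pose w x := `|f x| `^ beta.
have w0 x : 0 <= w x by exact: powR_ge0.
have lw : loc_bounded w by apply: loc_bounded_powR => //; exact: ltW.
pose s := (\int[mu]_x w x)%R.
have sE : (\int[mu]_x (w x)%:E = s%:E)%E.
  by rewrite fineK// ge0_fin_numE// ltW.
have s0 : 0 < s by rewrite -lte_fin -sE.
have iw : mu.-integrable [set: 'rV[R]_d] (EFin \o w).
  apply/integrableP; split; first by apply/measurable_EFinP; exact: (proj1 lw).
  by under eq_integral do rewrite /= ger0_norm//.
pose c := (s `^ beta^-1)^-1.
have c0 : 0 < c by rewrite invr_gt0 powR_gt0.
have cpow b : c `^ b = s `^ (- (beta^-1 * b)).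
  by rewrite /c -powRN -powRrM mulNr.
have cb : c `^ beta = s^-1 by rewrite cpow mulVf ?gt_eqF// powR_inv1// ltW.
have cb2 : c `^ (beta / 2) = (Num.sqrt s)^-1.
  by rewrite cpow mulrA mulVf ?gt_eqF// mul1r powRN powR12_sqrt// ltW.
pose h x := c * `|f x|.
pose G x := c * d%:R * eucl_norm (gradient f x).
have h0 x : 0 <= h x by rewrite mulr_ge0// ltW.
have G0 x : 0 <= G x by rewrite !mulr_ge0// ltW.
have lh : loc_bounded h by apply: loc_boundedM => //; exact: loc_bounded_cst.
have lgrad : loc_bounded (fun x => eucl_norm (gradient f x)).
  apply: loc_bounded_eucl_norm => i; apply: loc_bounded_continuous.
  by have [_ /(_ i)[_ []]] := sf 1%N.
have lG : loc_bounded G by apply: loc_boundedM => //; exact: loc_bounded_cst.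
have hb x : h x `^ beta = s^-1 * w x by rewrite powRM ?(ltW c0)// cb.
pose X x := `|f x| `^ (beta / 2).
have X0 x : 0 <= X x by exact: powR_ge0.
have lX : loc_bounded X by apply: loc_bounded_powR => //; rewrite divr_ge0// ltW.
have X2 x : X x ^+ 2 = w x by rewrite -powR_mulrn// -powRrM divfK.
have hb2 x : h x `^ (beta / 2) = (Num.sqrt s)^-1 * X x by rewrite powRM ?(ltW c0)// cb2.
have h1 : (\int[mu]_x (h x `^ beta)%:E <= 1)%E.
  under eq_integral do rewrite hb EFinM.
  rewrite ge0_integralZl_EFin ?invr_ge0 ?(ltW s0)//; last first.
  - by apply/measurable_EFinP; exact: (proj1 lw).
  - by move=> x _; rewrite lee_fin.
  by rewrite sE -EFinM mulVf// gt_eqF.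
have := HC h G lh lG h0 G0 (trunc_excess_local_upper_gradient sf c0) h1.
pose P x := relent (h x `^ beta).
have P0 x : 0 <= P x by exact/relent_ge0/powR_ge0.
have mP : measurable_fun [set: 'rV[R]_d] P.
  have lhb : loc_bounded (fun x => h x `^ beta) by apply: loc_bounded_powR => //; exact: ltW.
  suff [] : loc_bounded P by [].
  apply: loc_boundedD; last exact: loc_bounded_cst.
  apply: loc_boundedD; last exact: loc_boundedN.
  by apply: loc_bounded_xlnx => // x; exact: powR_ge0.
have -> : (\int[mu]_x (G x `^ beta)%:E = (s^-1 * d%:R `^ beta)%:E *
    \int[mu]_x (eucl_norm (gradient f x) `^ beta)%:E)%E.
  rewrite -ge0_integralZl_EFin//.
  - apply: eq_integral => x _; rewrite -EFinM; congr EFin.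
    by rewrite !powRM ?mulr_ge0 ?(ltW c0)// cb.
  - by move=> x _; rewrite lee_fin powR_ge0.
  - apply/measurable_EFinP; apply: (proj1 (loc_bounded_powR _ _ lgrad)) => //; exact: ltW.
  by rewrite mulr_ge0 ?powR_ge0 ?invr_ge0 ?(ltW s0).
have -> : (\int[mu]_x ((h x `^ (beta / 2) - 1) ^+ 2)%:E = (s^-1)%:E *
    \int[mu]_x ((X x - Num.sqrt s) ^+ 2)%:E)%E.
  have ss0 : 0 < Num.sqrt s by rewrite sqrtr_gt0.
  rewrite -ge0_integralZl_EFin//.
  - apply: eq_integral => x _; rewrite -EFinM; congr EFin.
    rewrite hb2 -{2}(sqr_sqrtr (ltW s0)); field; rewrite gt_eqF//.
  - by move=> x _; rewrite lee_fin sqr_ge0.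
  - apply/measurable_EFinP/measurable_funX/measurable_funB => //; exact: (proj1 lX).
  by rewrite invr_ge0 ltW.
set I := (\int[mu]_x (eucl_norm (gradient f x) `^ beta)%:E)%E.
set W := (\int[mu]_x ((X x - Num.sqrt s) ^+ 2)%:E)%E.
set V := ('V_mu[X])%E => HP.
have I0 : (0 <= I)%E by apply: integral_ge0 => x _; rewrite lee_fin powR_ge0.
have V0 : (0 <= V)%E by exact: variance_ge0.
have WV : (W <= 2%:E * V)%E.
  apply: integral_sqr_sub_le_variance => //; first exact: (proj1 lX).
  by under eq_integral do rewrite X2.
have bound : ((s^-1 * d%:R `^ beta)%:E * I + (s^-1)%:E * W <=
    (s^-1 * (d%:R `^ beta + 2))%:E * (I + V))%E.
  have si0 : 0 <= s^-1 by rewrite invr_ge0 ltW.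
  rewrite [leRHS]ge0_muleDr//; apply: leeD.
    by apply: lee_wpmul2r => //; rewrite lee_fin ler_wpM2l// lerDl.
  apply: (@le_trans _ _ ((s^-1)%:E * (2%:E * V))%E); first by apply: lee_wpmul2l.
  rewrite muleA -EFinM; apply: lee_wpmul2r => //.
  by rewrite lee_fin ler_wpM2l// lerDr powR_ge0.
(* The entropy integrand is [s] times the relative entropy density plus [w - s], which has mean
   zero. *)
have -> : entropy mu (fun x => `|f x| `^ beta) =
    (\int[mu]_x (s * P x + (w x - s))%:E)%E.
  apply: eq_integral => x _; congr EFin; rewrite -/(w x) -/s /P hb /relent /xlnx.
  by rewrite [s^-1 * w x]mulrC; field; rewrite gt_eqF.
have ints : mu.-integrable [set: 'rV[R]_d] (EFin \o (fun=> - s)).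
  exact: finite_measure_integrable_cst.
apply: (@le_trans _ _ (\int[mu]_x (s * P x)%:E)%E).
  apply: integralD_zero_mean_le.
  - exact: measurable_funM.
  - by move=> x; rewrite mulr_ge0// ltW.
  - exact: (integrableD measurableT iw ints).
  rewrite integralD_EFin// sE integral_cst//= probability_setT mule1.
  by rewrite -EFinD subrr.
under eq_integral do rewrite EFinM.
rewrite ge0_integralZl_EFin ?(ltW s0)//; last first.
- exact/measurable_EFinP.
- by move=> x _; rewrite lee_fin.
apply: (@le_trans _ _ (s%:E * (C%:E * ((s^-1 * (d%:R `^ beta + 2))%:E * (I + V))))%E).
  apply: lee_wpmul2l; first by rewrite lee_fin ltW.
  by apply: (le_trans HP); apply: lee_wpmul2l; rewrite // lee_fin ltW.
rewrite !muleA -!EFinM.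
have -> : s * C * (s^-1 * (d%:R `^ beta + 2)) = C * (d%:R `^ beta + 2).
  by field; rewrite gt_eqF.
by [].
Qed.
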